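(* Let $n$ and $a<n$ be positive integers. Fix a partition $\rho$ of $a$. There exists an explicit polynomial $Z_\rho$ in the variables $n$ and $m_1,\dots,m_{a-1}$ such that, for every partition $\lambda$ of $n$ with $m_i$ parts equal to $i$ (for $1\le i\le a-1$), one has $$\nu_\rho(\lambda)=\bigl(1+(-1)^a\,\varepsilon(\rho)\,\varepsilon(\lambda)\bigr)\,(n-a-1)!\;Z_\rho(n,m_1,\dots,m_{a-1}).$$
   Context: For a partition $\lambda$, $\varepsilon(\lambda)=(-1)^{|\lambda|-\ell(\lambda)}$ is the signature of any permutation of cycle type $\lambda$ ($|\lambda|$ is the size and $\ell(\lambda)$ the number of parts). For $\lambda\vdash n$ and $\rho\vdash a$, $\nu_\rho(\lambda)$ denotes the number of ways to write a given permutation $\sigma\in\mathfrak{S}_n$ of cycle type $\lambda$ as a product $\sigma=\alpha\cdot\beta$, where $\alpha$ is an $n$-cycle and $\beta$ has cycle type $(n-a)\cup\rho$ (the partition of $n$ whose parts are $n-a$ together with the parts of $\rho$). This number does not depend on the choice of $\sigma$ of type $\lambda$.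
   Formalization: A single polynomial Z_ρ for all n is claimed only when n−a is not a part of ρ (for ρ=(1), n≥3 forces Z=1, but n=2, λ=(2) gives ν=1, not 2); when n−a is a part of ρ, Z may depend on n. *)

(* Defs.v *)
From HB Require Import structures.
From mathcomp Require Import all_boot all_order all_fingroup all_algebra.
From mathcomp Require Import mpoly.

Set Implicit Arguments.
Unset Strict Implicit.
Unset Printing Implicit Defensive.

Import GRing.Theory Num.Theory.
Local Open Scope ring_scope.

(* Partitions are weakly decreasing sequences of positive parts. *)
Definition is_partition (n : nat) (l : seq nat) : bool :=
  [&& sorted geq l, 0%N \notin l & sumn l == n].

(* Union of partitions (as multisets of parts). *)
Definition part_union (l1 l2 : seq nat) : seq nat := sort geq (l1 ++ l2).

(* [porbits s] includes the singletons of the fixed points of [s], so this is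
   a partition of [#|T|]. *)
Definition cycle_type (T : finType) (s : {perm T}) : seq nat :=
  sort geq [seq #|C| | C : {set T} <- enum (porbits s)].

(* [size l <= sumn l] when the parts are positive, so the subtraction is not
   truncated on partitions. *)
Definition signature (l : seq nat) : rat := (-1) ^+ (sumn l - size l).

(* The number of factorisations s = alpha * beta with alpha an n-cycle and beta
   of cycle type (n - a) U rho.  MathComp composes permutations from left to
   right; since alpha beta = beta (beta^-1 alpha beta), the order of the two
   factors does not change the count. *)
Definition nu (n a : nat) (rho : seq nat) (s : 'S_n) : nat :=
  #|[set ab : 'S_n * 'S_n |
      [&& cycle_type ab.1 == [:: n],
          cycle_type ab.2 == part_union [:: (n - a)%N] rho
        & (ab.1 * ab.2)%g == s]]|.

(* The point (n, m_1, ..., m_(a-1)), where m_i is the number of parts of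
   [lambda] equal to i: coordinate 0 is n and coordinate i > 0 is m_i. *)
Definition size_mult (n a : nat) (lambda : seq nat) : 'I_a -> rat :=
  fun i => if val i == 0%N then n%:R else (count_mem (val i) lambda)%:R.

(* Main.v *)
Require Import Defs.
From HB Require Import structures.
From mathcomp Require Import all_boot all_order all_fingroup all_algebra.
From mathcomp Require Import mpoly ring zify.

Set Implicit Arguments.
Unset Strict Implicit.
Unset Printing Implicit Defensive.

Import GRing.Theory Num.Theory.
Local Open Scope ring_scope.

(* Let [chi_k] be the character of S_n on the [k]-th exterior power of its
   (n-1)-dimensional standard representation.  Its generating function is
     sum_k chi_k(s) X^k = prod_(i in type of s) (1 - (-X)^i) / (1 + X),
   and at X = -1 this shows that sum_k (-1)^k chi_k is n times the indicator
   function of the n-cycles.  As chi_k is irreducible of degree C(n-1, k),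
     sum_t chi_k(b^t s) = n! chi_k(b) chi_k(s) / C(n-1, k),
   and so n nu(s) = |B| sum_k (-1)^k chi_k(B) chi_k(s) / C(n-1, k), where B is
   the class of type (n-a) U rho.  With P_rho the generating function attached to
   rho, that of B is (1 - (-X)^(n-a)) P_rho: only the k < a and, symmetrically,
   the k >= n-a contribute, and pairing them gives the factor 1 +- eps(rho) eps(lambda).
   For k < a, chi_k(s) is a polynomial in m_1, ..., m_k, and the factorials in
   1 / C(n-1, k) leave (n-a-1)! times a polynomial in n.  Finally |B| (n-a) / n!
   does not depend on n as long as n-a is not a part of rho. *)

(** * Signs of permutations on the standard basis of the exterior algebra *)

(** For [i] in [S], this is the sign of moving [e_i] to the front of the wedge [e_S]. *)
Definition insert_sign n (S : {set 'I_n}) (i : 'I_n) : rat :=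
  \prod_(j in S) (-1) ^+ (j < i)%N.

(* The sign of the permutation that sorts the images under [s] of the elements
   of [S] listed in increasing order. *)
Definition ext_sign n (s : 'S_n) (S : {set 'I_n}) : rat :=
  \prod_(i in S) \prod_(j in S) (-1) ^+ ((i < j) && (s j < s i))%N.

Lemma imset_permM n (s t : 'S_n) (S : {set 'I_n}) :
  (s * t)%g @: S = t @: (s @: S).
Proof. by rewrite -imset_comp; apply: eq_imset => x; rewrite /= permM. Qed.

Lemma imset_perm1 n (S : {set 'I_n}) : (1%g : 'S_n) @: S = S.
Proof. by rewrite -[RHS]imset_id; apply: eq_imset => x; rewrite perm1. Qed.

Lemma imset_permD1 n (s : 'S_n) (S : {set 'I_n}) i :
  s @: (S :\ i) = (s @: S) :\ s i.
Proof.
apply/setP=> x; rewrite -[x](permKV s) !inE !(mem_imset _ _ (@perm_inj _ s)) !inE.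
by rewrite (inj_eq perm_inj).
Qed.

Lemma insert_sign_sqr n (S : {set 'I_n}) i : insert_sign S i * insert_sign S i = 1.
Proof. by rewrite -big_split big1 // => j _; rewrite /= -signr_addb addbb. Qed.

Lemma insert_signD1 n (S : {set 'I_n}) i j : j \in S ->
  insert_sign S i = (-1) ^+ (j < i)%N * insert_sign (S :\ j) i.
Proof. by move=> jS; rewrite /insert_sign (big_setD1 j). Qed.

Lemma insert_signU1 n (S : {set 'I_n}) i j : j \notin S ->
  insert_sign (j |: S) i = (-1) ^+ (j < i)%N * insert_sign S i.
Proof. by move=> jS; rewrite /insert_sign big_setU1. Qed.

(** Move [e_i] to the front of [e_S], apply [s], and move [e_(s i)] back to its place in the image.
    This recursion drives the inductions on [S] below. *)
Lemma ext_signD1 n (s : 'S_n) (S : {set 'I_n}) i : i \in S ->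
  ext_sign s S = insert_sign S i * insert_sign (s @: S) (s i) * ext_sign s (S :\ i).
Proof.
move=> iS; rewrite (insert_signD1 _ iS) ltnn mul1r.
rewrite (insert_signD1 _ (imset_f s iS)) ltnn mul1r -imset_permD1.
rewrite /insert_sign big_imset /=; last by apply: in2W; apply: perm_inj.
rewrite /ext_sign (big_setD1 i) //= (big_setD1 i) //= ltnn mul1r.
under [X in _ * X = _]eq_bigr => j _ do rewrite (big_setD1 i) //=.
rewrite [X in _ * X = _]big_split /= mulrA; congr (_ * _); rewrite -!big_split /=.
(* Together the pairs [(i, j)] and [(j, i)] contribute -1 exactly when [s] reverses the order of [i]
   and [j]. *)
apply: eq_bigr => j; rewrite !inE => /andP[nji _]; rewrite -!signr_addb.
have nsji : s j != s i by rewrite (inj_eq perm_inj).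
have : (j : nat) != i by []. have : (s j : nat) != s i by [].
by case: (ltngtP i j); case: (ltngtP (s i) (s j)).
Qed.

Lemma ext_sign0 n (s : 'S_n) : ext_sign s set0 = 1.
Proof. by rewrite /ext_sign big_set0. Qed.

Lemma ext_sign_sqr n (s : 'S_n) (S : {set 'I_n}) : ext_sign s S * ext_sign s S = 1.
Proof.
rewrite -big_split big1 // => i _; rewrite /= -big_split big1 // => j _.
by rewrite /= -signr_addb addbb.
Qed.

(** Functoriality of the exterior power. Peeling off one point creates the insertion sign of [s i]
    in [s @: S] twice, and its square is 1. *)
Lemma ext_signM n (s t : 'S_n) (S : {set 'I_n}) :
  ext_sign (s * t)%g S = ext_sign s S * ext_sign t (s @: S).
Proof.
have [k] := ubnP #|S|; elim: k S => // k IHk S leS.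
have [->|[i iS]] := set_0Vmem S; first by rewrite imset0 !ext_sign0 mulr1.
rewrite !(ext_signD1 _ iS) (ext_signD1 t (imset_f s iS)) -imset_permD1.
rewrite IHk; last by rewrite (cardsD1 i) iS in leS.
rewrite permM imset_permM.
have := insert_sign_sqr (s @: S) (s i).
move: (insert_sign _ _) => e; set x := insert_sign _ _; set y := insert_sign _ _.
by move=> e2; rewrite -[LHS]mul1r -e2; ring.
Qed.

Lemma ext_sign_id n (s : 'S_n) (S : {set 'I_n}) :
  {in S, forall i, s i = i} -> ext_sign s S = 1.
Proof.
move=> sS; rewrite /ext_sign big1 // => i iS; rewrite big1 // => j jS.
by rewrite !sS //; case: ltngtP.
Qed.

Lemma imset_tperm (T : finType) (S : {set T}) i j :
  i \in S -> j \in S -> tperm i j @: S = S.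
Proof.
move=> iS jS; apply/eqP; rewrite eqEcard card_imset ?leqnn ?andbT; last exact: perm_inj.
by apply/subsetP=> _ /imsetP[x xS ->]; case: tpermP => // ->.
Qed.

Lemma ext_sign_tperm n (S : {set 'I_n}) i j : i \in S -> j \in S -> i != j ->
  ext_sign (tperm i j) S = -1.
Proof.
move=> iS jS nij; have jSi : j \in S :\ i by rewrite !inE eq_sym nij.
have tS := imset_tperm iS jS.
rewrite (ext_signD1 _ iS) (ext_signD1 _ jSi) imset_permD1 tS tpermL tpermR.
rewrite ext_sign_id; last first.
  by move=> x; rewrite !inE => /and3P[nxj nxi _]; rewrite tpermD // eq_sym.
rewrite (insert_signD1 i jS) (insert_signD1 j iS).
have := insert_sign_sqr (S :\ j) i; have := insert_sign_sqr (S :\ i) j.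
move: (insert_sign _ _) (insert_sign _ _) => x y y2 x2.
have -> (b c : rat) : b * x * (c * y) * (y * x * 1) = b * c * (y * y) * (x * x) by ring.
rewrite x2 y2 !mulr1 -signr_addb; have : (i : nat) != j by [].
by case: ltngtP.
Qed.

(** The cross terms between [S] and [T] compare the order of [i, j] with that of [s i, s j]. As [s]
    permutes both sets, reindexing shows that the two resulting products are equal, so they
    cancel. *)
Lemma ext_signU n (s : 'S_n) (S T : {set 'I_n}) : [disjoint S & T] ->
  s @: S = S -> s @: T = T ->
  ext_sign s (S :|: T) = ext_sign s S * ext_sign s T.
Proof.
move=> dST sS sT.
have split_prod (G : 'I_n -> rat) : \prod_(i in S :|: T) G i =
    (\prod_(i in S) G i) * \prod_(i in T) G i.
  by rewrite (big_setID S) /= setUK setDUl setDv set0U (setDidPl _) // disjoint_sym.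
rewrite /ext_sign split_prod.
under eq_bigr => i _ do rewrite split_prod.
under [X in _ * X = _]eq_bigr => i _ do rewrite split_prod.
rewrite !big_split /= -mulrA; congr (_ * _).
rewrite mulrA -[RHS]mul1r; congr (_ * _).
rewrite [X in _ * X]exchange_big /= -big_split /=.
pose L (i j : 'I_n) : rat := (-1) ^+ (i < j)%N.
under eq_bigr => i iS.
  rewrite -big_split /=.
  rewrite (eq_bigr (fun j => L i j * L (s i) (s j))); last first.
    move=> j jT; rewrite -!signr_addb.
    have nij : (i : nat) != j.
      by apply: contraTneq jT => /val_inj <-; rewrite (disjointFr dST).
    have nsij : (s i : nat) != s j by rewrite (inj_eq val_inj) (inj_eq perm_inj).
    by move: nij nsij; case: (ltngtP i j); case: (ltngtP (s i) (s j)).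
  rewrite big_split /=.
over.
rewrite big_split /=.
have -> : \prod_(i in S) \prod_(j in T) L (s i) (s j) =
    \prod_(i in S) \prod_(j in T) L i j.
  rewrite -[in RHS]sS big_imset /=; last by apply: in2W; apply: perm_inj.
  apply: eq_bigr => i _; rewrite -[in RHS]sT big_imset //=.
  by apply: in2W; apply: perm_inj.
rewrite -big_split big1 // => i _; rewrite /= -big_split big1 // => j _.
by rewrite /= -signr_addb addbb.
Qed.

(** * Orbits, cycle types and insertion of a fixed point into a cycle *)

Lemma porbit_sub (T : finType) (s : {perm T}) (D : {set T}) x :
  {in D, forall z, s z \in D} -> x \in D -> porbit s x \subset D.
Proof.
move=> sD xD; apply/subsetP=> _ /porbitP[i ->].
by elim: i => [|i IHi]; rewrite ?expg0 ?perm1 // expgSr permM sD.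
Qed.

Lemma perm_porbit (T : finType) (s : {perm T}) x z :
  z \in porbit s x -> s z \in porbit s x.
Proof. by case/porbitP=> i ->; rewrite -permM -expgSr mem_porbit. Qed.

Lemma imset_porbit (T : finType) (s : {perm T}) x : s @: porbit s x = porbit s x.
Proof.
apply/eqP; rewrite eqEcard card_imset ?leqnn ?andbT; last exact: perm_inj.
by apply/subsetP=> _ /imsetP[z zx ->]; apply: perm_porbit.
Qed.

Lemma eq_in_porbit (T : finType) (s t : {perm T}) x :
  {in porbit s x, s =1 t} -> porbit t x = porbit s x.
Proof.
move=> st; have eqX i : (t ^+ i)%g x = (s ^+ i)%g x.
  elim: i => [|i IHi]; first by rewrite !expg0.
  by rewrite !expgSr !permM IHi -st ?mem_porbit.
by apply/setP=> z; apply/porbitP/porbitP=> -[i ->]; exists i; rewrite eqX.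
Qed.

Lemma porbit_morph (T U : finType) (f : T -> U) (s : {perm T}) (t : {perm U}) x :
  (forall z, t (f z) = f (s z)) -> porbit t (f x) = f @: porbit s x.
Proof.
move=> tf; have eqX i : (t ^+ i)%g (f x) = f ((s ^+ i)%g x).
  by elim: i => [|i IHi]; rewrite ?expg0 ?perm1 // !expgSr !permM IHi.
apply/setP=> z; apply/porbitP/imsetP=> [[i ->] | [_ /porbitP[i ->] ->]].
  by exists ((s ^+ i)%g x); rewrite ?mem_porbit.
by exists i.
Qed.

Lemma porbit_fix (T : finType) (s : {perm T}) x : s x = x -> porbit s x = [set x].
Proof.
move=> sx; apply/eqP; rewrite eqEsubset sub1set porbit_id andbT.
by apply: porbit_sub; rewrite ?set11 // => z /set1P->; rewrite sx set11.
Qed.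

(* Left multiplication by [tperm x y] inserts the fixed point [x] right after
   [y] in the cycle of [y]. *)
Lemma porbit_insert (T : finType) (s : {perm T}) x y : s x = x -> y != x ->
  porbit (tperm x y * s) y = x |: porbit s y.
Proof.
move=> sx nyx; set t := (_ * _)%g.
have ty : t y = x by rewrite permM tpermR.
have tx : t x = s y by rewrite permM tpermL.
have tz z : z != x -> z != y -> t z = s z.
  by move=> nzx nzy; rewrite permM tpermD // eq_sym.
have xNy : x \notin porbit s y by rewrite porbit_sym porbit_fix // inE.
apply/eqP; rewrite eqEsubset; apply/andP; split.
  apply: porbit_sub; last by rewrite !inE porbit_id orbT.
  move=> z; rewrite !inE => /predU1P[-> | zy].
    by rewrite tx perm_porbit ?orbT // porbit_id.
  have [-> | nzy] := eqVneq z y; first by rewrite ty eqxx.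
  rewrite tz ?perm_porbit ?orbT //.
  by apply: contraNneq xNy => <-.
have xty : x \in porbit t y by rewrite -ty perm_porbit // porbit_id.
rewrite subUset sub1set xty /=; apply/subsetP=> _ /porbitP[i ->].
elim: i => [|i IHi]; first by rewrite expg0 perm1 porbit_id.
rewrite expgSr permM; move: IHi (mem_porbit s i y); set z := (s ^+ i)%g y => IHi zy.
have [-> | nzy] := eqVneq z y; first by rewrite -tx perm_porbit.
by rewrite -tz ?perm_porbit //; apply: contraNneq xNy => <-.
Qed.

Lemma porbits_insert (T : finType) (s : {perm T}) x y : s x = x -> y != x ->
  porbits (tperm x y * s) =
    (x |: porbit s y) |: (porbits s :\ [set x] :\ porbit s y).
Proof.
move=> sx nyx; set t := (_ * _)%g.
have ty : porbit t y = x |: porbit s y by apply: porbit_insert.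
have tz z : z != x -> z \notin porbit s y -> porbit t z = porbit s z.
  move=> nzx zNy; apply: eq_in_porbit => w wz; rewrite permM tpermD //.
    by apply: contraNneq nzx => xw; rewrite porbit_sym -xw porbit_fix // inE in wz.
  by apply: contraNneq zNy => ->; rewrite porbit_sym.
apply/setP=> C; apply/imsetP/idP=> [[z _ ->] | ].
  have [zt | zNt] := boolP (z \in x |: porbit s y).
    by rewrite -ty -eq_porbit_mem in zt; rewrite (eqP zt) ty setU11.
  move: zNt; rewrite !inE negb_or => /andP[nzx zNy]; rewrite tz // imset_f // !andbT.
  rewrite eq_porbit_mem zNy /= -[X in _ != X](porbit_fix sx) eq_porbit_mem.
  by rewrite (porbit_fix sx) inE nzx orbT.
case/setU1P=> [-> | ]; first by exists y; rewrite ?ty.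
rewrite !inE => /and3P[nCy nCx /imsetP[z _ Cz]]; exists z => //.
rewrite tz // -?eq_porbit_mem -?Cz //; apply: contraNneq nCx => zx.
by rewrite Cz zx porbit_fix.
Qed.

Lemma perm_cycle_type (T : finType) (s : {perm T}) :
  perm_eq (cycle_type s) [seq #|C| | C : {set T} <- enum (porbits s)].
Proof. by rewrite perm_sort. Qed.

Lemma sort_geqP (l1 l2 : seq nat) :
  reflect (sort geq l1 = sort geq l2) (perm_eq l1 l2).
Proof.
apply: perm_sortP; first by move=> x y; apply: leq_total.
  by move=> x y z /= yx zy; apply: leq_trans zy yx.
by move=> x y /= /andP[yx xy]; apply/eqP; rewrite eqn_leq xy.
Qed.

Lemma big_cycle_type (R : Type) (idx : R) (op : Monoid.com_law idx)
    (T : finType) (s : {perm T}) (F : nat -> R) :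
  \big[op/idx]_(l <- cycle_type s) F l = \big[op/idx]_(C in porbits s) F #|C|.
Proof. by rewrite (perm_big _ (perm_cycle_type s)) big_map big_enum. Qed.

Lemma cycle_type_gt0 (T : finType) (s : {perm T}) : 0%N \notin cycle_type s.
Proof.
rewrite (perm_mem (perm_cycle_type s)); apply/mapP=> -[C].
rewrite mem_enum => /imsetP[x _ ->] /esym/eqP.
by rewrite (negPf (card_porbit_neq0 s x)).
Qed.

Lemma partition_porbits (T : finType) (s : {perm T}) : partition (porbits s) [set: T].
Proof.
apply/and3P; split.
- rewrite eqEsubset subsetT /=; apply/subsetP=> x _.
  by apply/bigcupP; exists (porbit s x); rewrite ?porbit_id // imset_f.
- apply/trivIsetP=> _ _ /imsetP[x _ ->] /imsetP[y _ ->]; apply: contraR.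
  case/pred0Pn=> z /= /andP[]; rewrite -!eq_porbit_mem => /eqP <- /eqP <-.
  exact: eqxx.
- by apply/imsetP=> -[x _ x0]; have := porbit_id s x; rewrite -x0 inE.
Qed.

Lemma sumn_cycle_type (T : finType) (s : {perm T}) : sumn (cycle_type s) = #|T|.
Proof.
by rewrite sumnE big_cycle_type -(card_partition (partition_porbits s)) cardsT.
Qed.

Lemma perm_enum_imset (T U : finType) (f : T -> U) (A : {set T}) :
  injective f -> perm_eq (enum (f @: A)) [seq f x | x <- enum A].
Proof.
move=> injf; apply: uniq_perm; rewrite ?enum_uniq ?map_inj_uniq ?enum_uniq //.
move=> y; rewrite mem_enum; apply/imsetP/mapP=> -[x xA ->]; exists x => //.
  by rewrite mem_enum.
by rewrite mem_enum in xA.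
Qed.

Lemma cycle_type_conj (T : finType) (s t : {perm T}) :
  cycle_type (s ^ t)%g = cycle_type s.
Proof.
have tst x : (s ^ t)%g (t x) = t (s x) by rewrite !permM permK.
have -> : cycle_type (s ^ t)%g =
    sort geq [seq #|C| | C : {set T} <- enum [set t @: (C : {set T}) | C in porbits s]].
  congr (sort geq [seq _ | C <- enum (_ : {set {set T}})]).
  apply/setP=> C; apply/imsetP/imsetP=> [[x _ ->] | [_ /imsetP[x _ ->] ->]].
    exists (porbit s (t^-1%g x)); first exact: imset_f.
    by rewrite -(porbit_morph _ tst) permKV.
  by exists (t x); rewrite // (porbit_morph _ tst).
apply/sort_geqP; apply: perm_trans (perm_map _ (perm_enum_imset _ _)) _.
  exact: imset_inj perm_inj.
rewrite -map_comp (eq_map (g := fun C : {set T} => #|C|)) // => C /=.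
by rewrite card_imset //; apply: perm_inj.
Qed.

Lemma cycle_typeV (T : finType) (s : {perm T}) : cycle_type s^-1%g = cycle_type s.
Proof. by rewrite /cycle_type porbitsV. Qed.

(** Induction on the length of the cycle: [s'] is [s] with [x = s y] cut out of the cycle of [y],
    and the transposition that puts it back contributes -1. *)
Lemma ext_sign_porbit n (s : 'S_n) x :
  ext_sign s (porbit s x) = - (-1) ^+ #|porbit s x|.
Proof.
have [k] := ubnP #|porbit s x|; elim: k s x => // k IHk s y lek.
have [sy | nsy] := eqVneq (s y) y.
  by rewrite porbit_fix // cards1 expr1 opprK ext_sign_id // => z /set1P->.
pose x := s y; pose s' : 'S_n := (tperm x y * s)%g.
have s'x : s' x = x by rewrite permM tpermL.
have nyx : y != x by rewrite eq_sym.
have ss' : s = (tperm x y * s')%g by rewrite mulgA tperm2 mul1g.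
have sE : porbit s y = x |: porbit s' y by rewrite [in LHS]ss' porbit_insert.
have xNy : x \notin porbit s' y by rewrite porbit_sym porbit_fix // inE.
have xs : x \in porbit s y by rewrite sE setU11.
have ys : y \in porbit s y by rewrite porbit_id.
rewrite {1}ss' ext_signM (ext_sign_tperm xs ys) 1?eq_sym //.
rewrite imset_tperm // sE ext_signU ?imset_porbit //; last 2 first.
- by rewrite disjoints1.
- by rewrite imset_set1 s'x.
rewrite ext_sign_id; last by move=> z /set1P->.
move: lek; rewrite sE cardsU1 xNy => lek.
by rewrite IHk // exprS !mulN1r mul1r.
Qed.

(** * Operators on the exterior algebra and hook characters *)

(** Transports an operator indexed by a finite type, here the subsets of ['I_n], to a square matrix,
    so that matrix products and traces apply. *)
Definition kernel_mx (I : finType) (F : I -> I -> rat) : 'M[rat]_#|I| :=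
  \matrix_(i, j) F (enum_val i) (enum_val j).

Lemma eq_kernel_mx (I : finType) (F G : I -> I -> rat) :
  F =2 G -> kernel_mx F = kernel_mx G.
Proof. by move=> FG; apply/matrixP=> i j; rewrite !mxE FG. Qed.

Lemma kernel_mxM (I : finType) (F G : I -> I -> rat) :
  kernel_mx F *m kernel_mx G = kernel_mx (fun x y => \sum_z F x z * G z y).
Proof.
apply/matrixP=> i j; rewrite !mxE [RHS](reindex (@enum_val I (mem I))) /=.
  by apply: eq_bigr => k _; rewrite !mxE.
by exists (@enum_rank I) => x _; rewrite ?enum_valK ?enum_rankK.
Qed.

Lemma kernel_mxD (I : finType) (F G : I -> I -> rat) :
  kernel_mx F + kernel_mx G = kernel_mx (fun x y => F x y + G x y).
Proof. by apply/matrixP=> i j; rewrite !mxE. Qed.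

Lemma mxtrace_kernel (I : finType) (F : I -> I -> rat) :
  \tr (kernel_mx F) = \sum_x F x x.
Proof.
rewrite /mxtrace [RHS](reindex (@enum_val I (mem I))) /=.
  by apply: eq_bigr => k _; rewrite !mxE.
by exists (@enum_rank I) => x _; rewrite ?enum_valK ?enum_rankK.
Qed.

Lemma kernel_mx_ex (I : finType) (A : 'M[rat]_#|I|) :
  A = kernel_mx (fun x y => A (enum_rank x) (enum_rank y)).
Proof. by apply/matrixP=> i j; rewrite !mxE !enum_valK. Qed.

Lemma kernel_mx_inj (I : finType) (F G : I -> I -> rat) :
  kernel_mx F = kernel_mx G -> F =2 G.
Proof.
by move=> /matrixP FG x y; have := FG (enum_rank x) (enum_rank y); rewrite !mxE !enum_rankK.
Qed.

Lemma sum_delta (I : finType) (F : I -> rat) x : \sum_y F y * (y == x)%:R = F x.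
Proof.
rewrite (bigD1 x) //= eqxx mulr1 big1 ?addr0 // => y /negPf->.
by rewrite mulr0.
Qed.

(* In the basis [e_S] of the exterior algebra of Q^n, [ext_mx s] is the action
   of [s], [del_mx] the contraction with the invariant linear form, and
   [add_mx k] the exterior product by [e_0] in degree [k]; all act on rows. *)
Definition ext_kernel n (s : 'S_n) (S T : {set 'I_n}) : rat :=
  ext_sign s S * (T == s @: S)%:R.
Definition ext_mx n (s : 'S_n) := kernel_mx (ext_kernel s).

Definition del_kernel n (S T : {set 'I_n}) : rat :=
  \sum_(i in S) insert_sign S i * (T == S :\ i)%:R.
Definition del_mx n := kernel_mx (@del_kernel n).

Definition add_kernel n k (S T : {set 'I_n.+1}) : rat :=
  [&& ord0 \notin S, #|S| == k & T == ord0 |: S]%:R.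
Definition add_mx n k := kernel_mx (@add_kernel n k).

Definition deg_kernel n k (S T : {set 'I_n}) : rat := ((#|S| == k) && (T == S))%:R.
Definition deg_mx n k := kernel_mx (@deg_kernel n k).

(* The character of the hook representation of shape (n + 1 - k, 1^k), realised
   on the kernel of [del_mx] in degree [k]. *)
Definition hook_char n k (s : 'S_n.+1) : rat :=
  \tr (add_mx n k *m del_mx n.+1 *m ext_mx s).

Definition ext_char n k (s : 'S_n) : rat := \tr (deg_mx n k *m ext_mx s).

Lemma ext_mxM n (s t : 'S_n) : ext_mx s *m ext_mx t = ext_mx (s * t)%g.
Proof.
rewrite kernel_mxM; apply: eq_kernel_mx => S T; rewrite /ext_kernel.
rewrite (eq_bigr (fun U => ext_sign s S * (ext_sign t U * (T == t @: U)%:R)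
   * (U == s @: S)%:R)); last by move=> U _; ring.
by rewrite sum_delta ext_signM imset_permM mulrA.
Qed.

(** The contracted linear form takes the same value on all basis vectors, hence is invariant under
    permutations; on entries this is [ext_signD1]. *)
Lemma del_ext_mx n (s : 'S_n) : del_mx n *m ext_mx s = ext_mx s *m del_mx n.
Proof.
rewrite !kernel_mxM; apply: eq_kernel_mx => S T.
transitivity (\sum_(i in S) insert_sign S i * ext_sign s (S :\ i)
    * (T == s @: (S :\ i))%:R).
  rewrite /del_kernel; under eq_bigr => U _ do rewrite mulr_suml.
  rewrite exchange_big /=; apply: eq_bigr => i iS; rewrite /ext_kernel.
  rewrite (eq_bigr (fun U => insert_sign S i * (ext_sign s U * (T == s @: U)%:R)
     * (U == S :\ i)%:R)); last by move=> U _; ring.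
  by rewrite sum_delta mulrA.
rewrite /ext_kernel.
rewrite (eq_bigr (fun U => ext_sign s S * del_kernel U T * (U == s @: S)%:R));
  last by move=> U _; ring.
rewrite sum_delta /del_kernel big_imset /=; last by apply: in2W; apply: perm_inj.
rewrite mulr_sumr; apply: eq_bigr => i iS; rewrite imset_permD1 mulrA; congr (_ * _).
rewrite (ext_signD1 s iS); have := insert_sign_sqr (s @: S) (s i).
move: (insert_sign _ (s i)) => x x2.
by rewrite -[LHS]mul1r -x2; ring.
Qed.

Lemma deg_ext_mx n k (s : 'S_n) : deg_mx n k *m ext_mx s =
  kernel_mx (fun S T : {set 'I_n} => (#|S| == k)%:R * ext_kernel s S T).
Proof.
rewrite kernel_mxM; apply: eq_kernel_mx => S T; rewrite /deg_kernel.
rewrite (eq_bigr (fun U => (#|S| == k)%:R * ext_kernel s U T * (U == S)%:R)).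
  by rewrite sum_delta.
by move=> U _; rewrite -mulnb natrM; ring.
Qed.

Lemma ext_charE n k (s : 'S_n) :
  ext_char k s = \sum_(S : {set 'I_n} | (#|S| == k) && (s @: S == S)) ext_sign s S.
Proof.
rewrite /ext_char deg_ext_mx mxtrace_kernel [RHS]big_mkcond; apply: eq_bigr => S _.
rewrite /ext_kernel (eq_sym S); case: (#|S| == k); case: (_ == S) => /=;
  by rewrite !(mul0r, mul1r, mulr1, mulr0).
Qed.

Lemma add_del_kernel n k (S T : {set 'I_n.+1}) :
  \sum_U add_kernel k S U * del_kernel U T =
  ((ord0 \notin S) && (#|S| == k))%:R * del_kernel (ord0 |: S) T.
Proof.
rewrite /add_kernel.
rewrite (eq_bigr (fun U => ((ord0 \notin S) && (#|S| == k))%:R * del_kernel U T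
  * (U == ord0 |: S)%:R)); first by rewrite sum_delta.
by move=> U _; rewrite andbA -mulnb natrM; ring.
Qed.

Lemma del_card n (S T : {set 'I_n}) : #|S| != #|T|.+1 -> del_kernel S T = 0.
Proof.
move=> nST; rewrite /del_kernel big1 // => i iS.
have [TS | _] := eqVneq T (S :\ i); last by rewrite mulr0.
by rewrite TS (cardsD1 i S) iS add1n eqxx in nST.
Qed.

Lemma del_add_kernel n k (S T : {set 'I_n.+1}) :
  \sum_U del_kernel S U * add_kernel k U T =
  ((ord0 \in T) && (#|T| == k.+1))%:R * del_kernel S (T :\ ord0).
Proof.
rewrite /add_kernel.
rewrite (eq_bigr (fun U => ((ord0 \in T) && (#|T| == k.+1))%:R * del_kernel S U
  * (U == T :\ ord0)%:R)); first by rewrite sum_delta.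
move=> U _; rewrite mulrC -mulrA (mulrC (del_kernel S U)) mulrA -natrM mulnb.
congr (_%:R * _); congr (nat_of_bool _).
apply/and3P/andP=> [[U0 /eqP Uk /eqP->] | [/andP[T0 /eqP Tk] /eqP ->]].
  by rewrite setU11 cardsU1 U0 Uk setU1K //= add1n !eqxx.
rewrite setD11 setD1K // eqxx; move: Tk.
by rewrite (cardsD1 ord0) T0 add1n => -[->]; rewrite eqxx.
Qed.

(** Leibniz rule for a contraction applied to [e_0] wedge [e_S]: as [ord0] is the least index,
    removing it costs no sign, and removing any other index costs one more. *)
Lemma del_kernelU1 n (S T : {set 'I_n.+1}) : ord0 \notin S ->
  del_kernel (ord0 |: S) T = (T == S)%:R -
    \sum_(i in S) insert_sign S i * (T == ord0 |: (S :\ i))%:R.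
Proof.
move=> S0; rewrite /del_kernel big_setU1 //= setU1K //; congr (_ + _).
  rewrite /insert_sign big1 ?mul1r // => j _; by rewrite ltn0.
rewrite -sumrN; apply: eq_bigr => i iS; rewrite insert_signU1 //.
have ni0 : i != ord0 by apply: contraNneq S0 => <-.
have -> : ((ord0 : 'I_n.+1) < i)%N by rewrite lt0n.
rewrite expr1 mulN1r mulNr; congr (- (_ * (_ == _)%:R)).
by apply/setP=> j; rewrite !inE; case: (eqVneq j ord0) => [->|]; rewrite //= eq_sym ni0.
Qed.

(* Multiplication by [e_0] is a contracting homotopy for [del_mx]. *)
Lemma deg_mxS n k :
  deg_mx n.+1 k.+1 = add_mx n k.+1 *m del_mx n.+1 + del_mx n.+1 *m add_mx n k.
Proof.
rewrite !kernel_mxM kernel_mxD; apply: eq_kernel_mx => S T.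
rewrite add_del_kernel del_add_kernel /deg_kernel.
have [Sk | nSk] /= := eqVneq #|S| k.+1; last first.
  rewrite andbF mul0r add0r.
  case: (boolP (_ && _)) => [/andP[T0 /eqP Tk] | _]; last by rewrite mul0r.
  rewrite del_card ?mulr0 //; apply: contraNneq nSk => ->.
  by move: Tk; rewrite (cardsD1 ord0) T0 add1n => -[->].
have -> : ((ord0 \in T) && (#|T| == k.+1))%:R * del_kernel S (T :\ ord0) =
  \sum_(i in S) insert_sign S i * ((ord0 \in T) && (T :\ ord0 == S :\ i))%:R.
  rewrite /del_kernel mulr_sumr; apply: eq_bigr => i iS.
  rewrite mulrCA -natrM mulnb; congr (_ * (_ : bool)%:R).
  case: (boolP (ord0 \in T)) => //= T0.
  case: (eqVneq (T :\ ord0)) => TS; rewrite ?andbF // andbT.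
  rewrite (cardsD1 ord0 T) T0 TS; move: Sk.
  by rewrite (cardsD1 i S) iS !add1n => -[->]; rewrite eqxx.
have [S0 | S0] /= := boolP (ord0 \in S).
  rewrite mul0r add0r (bigD1 ord0) //= big1 ?addr0; last first.
    move=> i /andP[iS ni0].
    case: eqP => [/setP/(_ ord0) | _]; last by rewrite andbF mulr0.
    by rewrite !inE eqxx S0 eq_sym ni0.
  rewrite [insert_sign _ _]big1 ?mul1r => [|j _]; last by rewrite ltn0.
  congr (_ : bool)%:R; apply/eqP/andP=> [-> // | [T0 /eqP TS]].
  by rewrite -(setD1K T0) TS setD1K.
rewrite mul1r del_kernelU1 // -addrA -sumrN -big_split /= big1 ?addr0 // => i iS.
rewrite -mulrN -mulrDr -[RHS](mulr0 (insert_sign S i)); congr (_ * _).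
apply/eqP; rewrite addrC subr_eq0; apply/eqP; congr (_ : bool)%:R.
apply/andP/eqP=> [[T0 /eqP <-] | ->]; first by rewrite setD1K.
by rewrite setU11 setU1K // !inE negb_and S0 orbT.
Qed.

Lemma deg_mx0 n : deg_mx n.+1 0 = add_mx n 0 *m del_mx n.+1.
Proof.
rewrite !kernel_mxM; apply: eq_kernel_mx => S T.
rewrite add_del_kernel /deg_kernel.
case: (eqVneq #|S| 0%N) => [/eqP | _]; last by rewrite andbF mul0r.
rewrite cards_eq0 => /eqP->; rewrite inE mul1r del_kernelU1 ?inE //.
by rewrite big_set0 subr0.
Qed.

Lemma ext_char0 n (s : 'S_n.+1) : ext_char 0 s = hook_char 0 s.
Proof. by rewrite /ext_char deg_mx0. Qed.

(** Trace of the homotopy formula against [s]: since [del_mx] commutes with [s], cyclicity of the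
    trace turns the second term into the hook character one degree lower. *)
Lemma ext_charS n k (s : 'S_n.+1) :
  ext_char k.+1 s = hook_char k.+1 s + hook_char k s.
Proof.
rewrite /ext_char deg_mxS mulmxDl mxtraceD; congr (_ + _).
by rewrite -mulmxA mxtrace_mulC -mulmxA -del_ext_mx mulmxA.
Qed.

Lemma hook_char_gt n k (s : 'S_n.+1) : (n < k)%N -> hook_char k s = 0.
Proof.
move=> ltnk; rewrite /hook_char; suff -> : add_mx n k = 0 by rewrite !mul0mx mxtrace0.
apply/matrixP=> i j; rewrite !mxE /add_kernel.
case: eqP => [Sk | _]; rewrite ?andbF //.
suff -> : enum_val i = [set: 'I_n.+1] by rewrite inE.
by apply/eqP; rewrite eqEcard subsetT cardsT card_ord Sk.
Qed.

Lemma hook_char1 n k : hook_char k (1%g : 'S_n.+1) = 'C(n, k)%:R.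
Proof.
have ext1 j : ext_char j (1%g : 'S_n.+1) = 'C(n.+1, j)%:R.
  rewrite ext_charE (eq_bigl (fun S : {set 'I_n.+1} => #|S| == j)).
    rewrite (eq_bigr (fun=> 1)).
      by rewrite sumr_const; have := card_draws 'I_n.+1 j; rewrite card_ord cardsE => <-.
    by move=> S _; rewrite ext_sign_id // => i _; rewrite perm1.
  by move=> S; rewrite imset_perm1 eqxx andbT.
elim: k => [|k IHk]; first by rewrite -ext_char0 ext1 !bin0.
by apply: (addIr (hook_char k (1%g : 'S_n.+1))); rewrite -ext_charS ext1 IHk binS natrD.
Qed.

(** * Schur's lemma for hooks *)

Lemma perm_map_uniq (T : finType) (l1 l2 : seq T) :
  uniq l1 -> uniq l2 -> size l1 = size l2 -> exists s : {perm T}, map s l1 = l2.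
Proof.
elim: l1 l2 => [|x l1 IHl] [|y l2] //=; first by exists 1%g.
case/andP=> xl1 ul1 /andP[yl2 ul2] [szl]; have [s sl] := IHl _ ul1 ul2 szl.
exists (s * tperm (s x) y)%g; rewrite permM tpermL; congr (_ :: _); rewrite -sl.
apply/eq_in_map=> z zl1; rewrite permM tpermD //.
  by rewrite (inj_eq perm_inj); apply: contraNneq xl1 => ->.
by apply: contraNneq yl2 => ->; rewrite -sl map_f.
Qed.

Lemma perm_pointed_set (T : finType) (S S' : {set T}) i i' :
  i \in S -> i' \in S' -> #|S| = #|S'| ->
  exists s : {perm T}, s @: S = S' /\ s i = i'.
Proof.
move=> iS iS' cS.
have [] := @perm_map_uniq T (i :: enum (S :\ i)) (i' :: enum (S' :\ i')).
- by rewrite /= enum_uniq mem_enum setD11.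
- by rewrite /= enum_uniq mem_enum setD11.
- by move: cS; rewrite /= -!cardE (cardsD1 i) iS (cardsD1 i' S') iS'.
move=> s [si sl]; exists s; split=> //; apply/setP=> x; rewrite -(setD1K iS').
apply/imsetP/setU1P=> [[z zS ->] | ].
  have [-> | nzi] := eqVneq z i; first by left.
  by right; rewrite -mem_enum -sl map_f // mem_enum !inE nzi.
case=> [-> | ]; first by exists i.
by rewrite -mem_enum -sl => /mapP[z]; rewrite mem_enum !inE => /andP[_ zS] ->; exists z.
Qed.

(* Schur's lemma for hooks: a transposition of two points of [S] outside [T]
   forces [N S T = 0], so that only the pairs [(S, S :\ i)] matter, and these
   are permuted transitively. *)
Lemma equivariant_lowering n (N : {set 'I_n} -> {set 'I_n} -> rat) k :
  (forall S T : {set 'I_n}, #|S| != #|T|.+1 -> N S T = 0) ->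
  (forall s (S T : {set 'I_n}),
     ext_sign s S * N (s @: S) (s @: T) = N S T * ext_sign s T) ->
  exists c, forall S T : {set 'I_n}, #|S| = k.+1 -> N S T = c * del_kernel S T.
Proof.
move=> Ndeg Neq.
have Nsub (S T : {set 'I_n}) : #|S| = #|T|.+1 -> ~~ (T \subset S) -> N S T = 0.
  move=> cST nTS; have cD : (1 < #|S :\: T|)%N.
    rewrite cardsD; have := subset_leq_card (subsetIr S T).
    have : #|S :&: T| != #|T|.
      apply: contraNneq nTS => cI; suff <- : S :&: T = T by rewrite subsetIl.
      by apply/eqP; rewrite eqEcard subsetIr cI leqnn.
    by rewrite cST; lia.
  have [i [j [iD jD nij]]] := card_gt1P cD.
  have := Neq (tperm i j) S T; move: iD jD; rewrite !inE => /andP[iT iS] /andP[jT jS].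
  have tT : {in T, forall x, tperm i j x = x}.
    by move=> x xT; rewrite tpermD //; [apply: contraNneq iT | apply: contraNneq jT] => ->.
  have tTE : tperm i j @: T = T by rewrite -[RHS]imset_id; apply: eq_in_imset.
  rewrite imset_tperm // tTE ext_sign_tperm // (ext_sign_id tT) mulN1r mulr1 => /eqP.
  by rewrite eq_sym -addr_eq0 -mulr2n mulrn_eq0 => /eqP.
have delD1 (S : {set 'I_n}) i : i \in S -> del_kernel S (S :\ i) = insert_sign S i.
  move=> iS; rewrite /del_kernel (bigD1 i) //= eqxx mulr1 big1 ?addr0 // => j /andP[jS nji].
  case: eqP => [/setP/(_ i) | _]; last by rewrite mulr0.
  by rewrite !inE eqxx iS eq_sym nji.
have Nprop (S S' : {set 'I_n}) i i' : i \in S -> i' \in S' -> #|S| = #|S'| ->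
    N S (S :\ i) * insert_sign S i = N S' (S' :\ i') * insert_sign S' i'.
  move=> iS iS' cS; have [s [sS si]] := perm_pointed_set iS iS' cS.
  have := Neq s S (S :\ i); rewrite imset_permD1 sS si (ext_signD1 s iS) sS si.
  have := insert_sign_sqr S i; have := insert_sign_sqr S' i'.
  have := ext_sign_sqr s (S :\ i).
  move: (insert_sign S i) (insert_sign S' i') (ext_sign _ _) (N _ _) (N _ _).
  move=> x y z u v z2 y2 x2 E.
  rewrite -[LHS]mulr1 -z2; transitivity (u * z * (x * z)); first by ring.
  by rewrite -E; transitivity (x * x * (z * z) * (v * y)); [ring | rewrite x2 z2 !mul1r].
have dec (S T : {set 'I_n}) : #|S| = #|T|.+1 -> T \subset S ->
    exists2 i, i \in S & T = S :\ i.
  move=> cST sTS; have : #|S :\: T| == 1%N.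
    by rewrite cardsD (setIidPr sTS) cST subSnn.
  case/cards1P=> i Di; have : i \in S :\: T by rewrite Di set11.
  rewrite inE => /andP[iT iS]; exists i => //; rewrite -Di setDDr setDv set0U.
  by rewrite (setIidPr sTS).
have [[S0 i0] | nok] :=
  pickP [pred p : {set 'I_n} * 'I_n | (p.2 \in p.1) && (#|p.1| == k.+1)].
  rewrite /= => /andP[iS0 /eqP S0k].
  (* The scalar is read off at one reference pair and carried to the others by [Nprop]. *)
  exists (N S0 (S0 :\ i0) * insert_sign S0 i0) => S T Sk.
  have [cST | ncST] := eqVneq #|S| #|T|.+1; last by rewrite Ndeg // del_card // mulr0.
  have [sTS | nTS] := boolP (T \subset S).
    have [i iS ->] := dec S T cST sTS.
    rewrite (@Nprop S0 S i0 i) // ?delD1 ?S0k //.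
    by rewrite -mulrA insert_sign_sqr mulr1.
  rewrite Nsub // /del_kernel big1 ?mulr0 // => i iS.
  by case: eqP nTS => [-> | _ _]; rewrite ?subD1set ?mulr0.
(* Here no set has [k.+1] elements, so any scalar would do. *)
exists 0 => S T Sk; have [i iS] : exists i, i \in S by apply/set0Pn; rewrite -card_gt0 Sk.
by have := nok (S, i); rewrite /= iS Sk eqxx.
Qed.

(** * Generating functions of the exterior and hook characters *)

Lemma exprNX c : (- 'X) ^+ c = ((-1) ^+ c)%:P * 'X^c :> {poly rat}.
Proof. by rewrite [LHS]exprNn polyC_exp polyCN. Qed.

(** This is det(1 + X s) for the permutation matrix of any [s] of cycle type [l]. *)
Definition cycle_poly (l : seq nat) : {poly rat} := \prod_(i <- l) (1 - (- 'X) ^+ i).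

Lemma cover_imset n (s : 'S_n) (P : {set {set 'I_n}}) :
  P \subset porbits s -> s @: cover P = cover P.
Proof.
move=> sP; apply/eqP; rewrite eqEcard card_imset ?leqnn ?andbT; last exact: perm_inj.
apply/subsetP=> _ /imsetP[x /bigcupP[C CP xC] ->]; apply/bigcupP; exists C => //.
have /imsetP[y _ Cy] := subsetP sP C CP.
by rewrite Cy perm_porbit -?Cy.
Qed.

(** Each orbit [C] contributes [- (-1) ^+ #|C|] and the orbits multiply by [ext_signU]; the extra
    power of -1 reduces every contribution to -1. *)
Lemma ext_sign_cover n (s : 'S_n) (P : {set {set 'I_n}}) : P \subset porbits s ->
  ext_sign s (cover P) * (-1) ^+ #|cover P| = \prod_(C in P) (-1).
Proof.
have [k] := ubnP #|P|; elim: k P => // k IHk P leP sP.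
have [-> | [C CP]] := set_0Vmem P.
  by rewrite /cover big_set0 ext_sign0 cards0 big_set0 mulr1.
have sP' : P :\ C \subset porbits s by apply: subset_trans sP; apply: subsetDl.
have coverP : cover P = C :|: cover (P :\ C).
  by rewrite /cover (big_setD1 C).
have [x _ Cx] := imsetP (subsetP sP C CP).
have dC : [disjoint C & cover (P :\ C)].
  have /and3P[_ /trivIsetP tP _] := partition_porbits s.
  apply/bigcup_disjointP=> D; rewrite !inE => /andP[nDC DP].
  by apply: tP; rewrite ?(subsetP sP) // eq_sym.
rewrite coverP cardsU (disjoint_setI0 dC) cards0 subn0 exprD.
rewrite ext_signU ?cover_imset //; last by rewrite Cx imset_porbit.
rewrite mulrACA IHk //; last by rewrite (cardsD1 C) CP in leP.
rewrite [RHS](big_setD1 C) //= {1 2}Cx ext_sign_porbit mulNr -exprD addnn.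
by rewrite -muln2 exprM sqrr_sign.
Qed.

(** Only the [s]-stable subsets contribute to the trace. They are the unions of orbits, and
    expanding the product over the orbits enumerates these unions. *)
Lemma coef_cycle_poly n (s : 'S_n) k :
  (cycle_poly (cycle_type s))`_k = ext_char k s.
Proof.
have /and3P[_ tP _] := partition_porbits s.
have block (J : {set {set 'I_n}}) C : J \subset porbits s -> C \in porbits s ->
    C \subset cover J -> C \in J.
  move=> sJP /[dup] CP /imsetP[x _ Cx] /subsetP/(_ x).
  rewrite Cx porbit_id => /(_ isT)/bigcupP[D DJ]; have /imsetP[y _ Dy] := subsetP sJP D DJ.
  by rewrite Dy -eq_porbit_mem => /eqP ->; rewrite -Dy.
pose blocks (S : {set 'I_n}) := [set C in porbits s | C \subset S].
have cover_blocks (S : {set 'I_n}) : s @: S == S -> cover (blocks S) = S.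
  move=> /eqP sS; apply/eqP; rewrite eqEsubset; apply/andP; split.
    by apply/bigcupsP=> C; rewrite inE => /andP[].
  apply/subsetP=> x xS; apply/bigcupP; exists (porbit s x); last exact: porbit_id.
  rewrite inE imset_f //=; apply: porbit_sub xS => z zS.
  by rewrite -sS imset_f.
rewrite ext_charE (reindex_onto cover blocks); last by move=> S /andP[_ /cover_blocks].
rewrite /cycle_poly big_cycle_type big_mkcond.
(* The product is extended to all sets [C], with 0 as the non-unit term off the orbits, so that
   expanding it gives a sum over all families [J]; those not made of orbits contribute 0. *)
under eq_bigr => C _.
  rewrite (_ : (if _ then _ else _) =
      (if C \in porbits s then - (- 'X) ^+ #|C| else 0) + 1);
    last by case: ifP => _; rewrite ?add0r // addrC.
over.
rewrite bigA_distr coef_sum [RHS]big_mkcond; apply: eq_bigr => J _.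
rewrite -big_mkcond /=.
have [sJP | nsJP] := boolP (J \subset porbits s); last first.
  have [C CJ CNP] := subsetPn nsJP.
  rewrite (bigD1 C) //= (negPf CNP) mul0r coef0; case: ifP => // /andP[_ /eqP bJ].
  by move: CJ; rewrite -bJ inE (negPf CNP).
have -> : blocks (cover J) = J.
  apply/setP=> C; rewrite inE; apply/andP/idP => [[CP] | CJ]; first exact: block.
  by rewrite (subsetP sJP) //; split=> //; apply: bigcup_sup.
rewrite cover_imset // !eqxx !andbT.
rewrite (eq_bigr (fun C : {set 'I_n} => (-1)%:P * (- 'X) ^+ #|C|)); last first.
  by move=> C /(subsetP sJP) ->; rewrite polyCN mulNr mul1r.
rewrite big_split /= -rmorph_prod /= -(ext_sign_cover sJP) prodrXr.
rewrite exprNX (eqP (trivIsetS sJP tP)) mulrA -polyCM.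
rewrite -mulrA -exprD addnn -muln2 exprM sqrr_sign mulr1.
by rewrite coefCM coefXn eq_sym; case: eqP => _; rewrite ?mulr1 ?mulr0.
Qed.

Lemma hook_char_cycle_type n k (s t : 'S_n.+1) :
  cycle_type s = cycle_type t -> hook_char k s = hook_char k t.
Proof.
move=> st; have ext_st j : ext_char j s = ext_char j t by rewrite -!coef_cycle_poly st.
elim: k => [|k IHk]; first by rewrite -!ext_char0.
by apply: (addIr (hook_char k s)); rewrite -ext_charS [in RHS]IHk -ext_charS.
Qed.

Definition hook_poly n (s : 'S_n.+1) : {poly rat} := \poly_(k < n.+1) hook_char k s.

Lemma coef_hook_poly n (s : 'S_n.+1) k : (hook_poly s)`_k = hook_char k s.
Proof. by rewrite coef_poly ltnS; case: leqP => // /hook_char_gt ->. Qed.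

Lemma mul_hook_poly n (s : 'S_n.+1) :
  (1 + 'X) * hook_poly s = cycle_poly (cycle_type s).
Proof.
apply/polyP=> -[|k]; rewrite coef_cycle_poly mulrDl mul1r coefD coefXM /= coef_hook_poly.
  by rewrite addr0 ext_char0.
by rewrite coef_hook_poly ext_charS.
Qed.

(** The sum [M] over the conjugates of [b] commutes with the group, so [del_mx] followed by [M] is
    an equivariant lowering map, a scalar [c] times [del_mx] in degree [k.+1]. Taking traces gives
    [c * hook_char k s], and the identity permutation determines [c]. *)
Lemma hook_char_functional n k (b s : 'S_n.+1) :
  (\sum_t hook_char k ((b ^ t) * s)%g) * 'C(n, k)%:R =
  (n.+1)`!%:R * hook_char k b * hook_char k s.
Proof.
pose M := \sum_t ext_mx (b ^ t)%g; pose N := del_mx n.+1 *m M.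
have MC t : ext_mx t *m M = M *m ext_mx t.
  rewrite mulmx_sumr mulmx_suml (reindex_inj (mulIg t)) /=; apply: eq_bigr => u _.
  by rewrite !ext_mxM conjgM -conjgC.
have NC t : ext_mx t *m N = N *m ext_mx t.
  by rewrite mulmxA -del_ext_mx -!mulmxA MC.
pose NK (S T : {set 'I_n.+1}) := N (enum_rank S) (enum_rank T).
have NE : N = kernel_mx NK by apply: kernel_mx_ex.
have [c cP] : exists c, forall S T : {set 'I_n.+1},
    #|S| = k.+1 -> NK S T = c * del_kernel S T.
  apply: equivariant_lowering => [S T nST | t S T].
    rewrite /NK /N mulmx_sumr summxE big1 // => t _.
    rewrite kernel_mxM mxE !enum_rankK big1 // => U _; rewrite /ext_kernel.
    have [TU | _] := eqVneq T _; last by rewrite !mulr0.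
    by rewrite del_card ?mul0r //; move: nST; rewrite TU card_imset //; apply: perm_inj.
  have := NC t; rewrite NE !kernel_mxM => /kernel_mx_inj/(_ S (t @: T)) /=.
  rewrite /ext_kernel; under eq_bigr => U _ do rewrite mulrAC.
  rewrite sum_delta => ->.
  rewrite (eq_bigr (fun U => NK S U * ext_sign t U * (U == T)%:R)) ?sum_delta //.
  by move=> U _; rewrite mulrA (eq_sym U) (inj_eq (imset_inj (@perm_inj _ t))).
have addN : add_mx n k *m N = c *: (add_mx n k *m del_mx n.+1).
  rewrite NE !kernel_mxM; apply/matrixP=> i j; rewrite !mxE mulr_sumr; apply: eq_bigr => U _.
  rewrite /add_kernel; case: and3P => [[S0 /eqP Sk /eqP US] | _]; last by rewrite !mul0r mulr0.
  by rewrite !mul1r cP // US cardsU1 S0 Sk.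
have sumE t : \sum_u hook_char k ((b ^ u) * t)%g = c * hook_char k t.
  rewrite /hook_char -mxtraceZ scalemxAl -addN -mulmxA /N /M.
  rewrite -!mulmxA mulmx_suml !mulmx_sumr raddf_sum /=; apply: eq_bigr => u _.
  by rewrite ext_mxM !mulmxA.
have := sumE 1%g; rewrite hook_char1.
under eq_bigr => t _ do rewrite mulg1 (hook_char_cycle_type _ (cycle_type_conj b t)).
rewrite sumr_const cardT -cardE card_Sn mulr_natl sumE => ->.
by rewrite mulrAC.
Qed.

(** * Symmetry of hook polynomials, their value at -1, and the character formula *)

Lemma cycle_poly_cons i l : cycle_poly (i :: l) = (1 - (- 'X) ^+ i) * cycle_poly l.
Proof. by rewrite /cycle_poly big_cons. Qed.

Lemma oneX_neq0 : 1 + 'X != 0 :> {poly rat}.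
Proof. by apply/eqP=> /polyP/(_ 0%N); rewrite coefD coef1 coefX coef0. Qed.

Lemma oneX_factor i :
  1 - (- 'X) ^+ i = (1 + 'X) * \sum_(j < i) (- 'X) ^+ j :> {poly rat}.
Proof. by rewrite -opprB subrX1 -mulNr opprB opprK. Qed.

Lemma cycle_poly_factor i l p : (1 + 'X) * p = cycle_poly (i :: l) ->
  p = (\sum_(j < i) (- 'X) ^+ j) * cycle_poly l.
Proof. by rewrite cycle_poly_cons oneX_factor -mulrA => /(mulfI oneX_neq0). Qed.

Lemma size_cycle_poly l : (size (cycle_poly l) <= (sumn l).+1)%N.
Proof.
elim: l => [|i l IHl]; first by rewrite /cycle_poly big_nil size_poly1.
rewrite cycle_poly_cons; apply: leq_trans (size_polyMleq _ _) _ => /=.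
suff szi : (size (1 - (- 'X) ^+ i : {poly rat})%R <= i.+1)%N.
  by have := leq_add szi IHl; rewrite addnS; case: (_ + _)%N.
apply: leq_trans (size_polyD _ _) _; rewrite size_polyN geq_max size_poly1 /=.
by rewrite exprNn -signr_odd mulr_sign; case: ifP; rewrite ?size_polyN size_polyXn.
Qed.

Lemma size_hook_poly l p : (1 + 'X) * p = cycle_poly l -> (size p <= sumn l)%N.
Proof.
move=> pl; have [-> | p0] := eqVneq p 0; first by rewrite size_poly0.
have := size_cycle_poly l; rewrite -pl size_mul ?oneX_neq0 //.
by rewrite addrC -[1]/(1%:P) size_XaddC.
Qed.

Lemma signature_cons i l : (0 < i)%N -> 0%N \notin l ->
  signature (i :: l) = - (-1) ^+ i * signature l.
Proof.
move=> i0 l0; rewrite /signature /=.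
have szl : (size l <= sumn l)%N.
  elim: l l0 => //= j l IHl; rewrite inE negb_or => /andP[j0 /IHl].
  by rewrite eq_sym -lt0n in j0; lia.
have -> : (i + sumn l - (size l).+1 = i.-1 + (sumn l - size l))%N by lia.
by rewrite exprD; case: i i0 => // i _; rewrite exprS mulN1r opprK.
Qed.

(** Factor by factor, x^i (1 - (-1/x)^i) = -(-1)^i (1 - (-x)^i), and the product of the signs
    -(-1)^i is the signature. *)
Lemma cycle_poly_inv l x : 0%N \notin l -> x != 0 ->
  x ^+ sumn l * (cycle_poly l).[x^-1] = signature l * (cycle_poly l).[x].
Proof.
move=> + x0; elim: l => [|i l IHl].
  by rewrite /signature /cycle_poly big_nil !hornerE.
rewrite inE negb_or eq_sym -lt0n => /andP[i0 l0].
rewrite signature_cons // cycle_poly_cons !hornerM /= exprD mulrACA IHl //.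
rewrite [RHS]mulrACA; congr (_ * _); rewrite !hornerE.
rewrite [(- x^-1) ^+ i]exprNn [(- x) ^+ i]exprNn exprVn.
have e2 : (-1) ^+ i * (-1) ^+ i = 1 :> rat by rewrite -expr2 sqrr_sign.
have y0 : x ^+ i != 0 by rewrite expf_neq0.
rewrite !mulrBr !mulr1 mulrCA divff // mulr1 mulrA mulNr e2.
by rewrite mulN1r opprK addrC.
Qed.

(** A nonzero polynomial has finitely many roots. Positive integers are used as test points because
    neither x nor 1 + x vanishes there. *)
Lemma poly_eq_nat (p q : {poly rat}) :
  (forall i, p.[i.+1%:R] = q.[i.+1%:R]) -> p = q.
Proof.
move=> pq; apply/eqP; rewrite -subr_eq0; apply/eqP.
apply: (@roots_geq_poly_eq0 _ _ [seq i.+1%:R | i <- iota 0 (size (p - q))]).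
- by apply/allP=> _ /mapP[i _ ->]; rewrite rootE !hornerE pq subrr.
- rewrite map_inj_uniq ?iota_uniq // => i j /eqP; rewrite eqr_nat => /eqP[].
  exact: id.
- by rewrite size_map size_iota.
Qed.

(* Hook characters of conjugate shapes differ by the sign character. *)
Lemma hook_poly_sym l N p k : 0%N \notin l -> sumn l = N.+1 ->
  (1 + 'X) * p = cycle_poly l -> (k <= N)%N -> p`_(N - k) = signature l * p`_k.
Proof.
move=> l0 lN pl leN; pose q := \poly_(j < N.+1) p`_(N - j).
have szp : (size p <= N.+1)%N by rewrite -lN; apply: size_hook_poly.
have qE x : x != 0 -> q.[x] = x ^+ N * p.[x^-1].
  move=> x0; rewrite horner_poly (horner_coef_wide _ szp) mulr_sumr.
  rewrite (reindex_inj rev_ord_inj) /=; apply: eq_bigr => j _.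
  have jN : (j <= N)%N by rewrite -ltnS.
  rewrite subSS subKn // mulrCA; congr (_ * _).
  by rewrite exprVn; apply: (canRL (mulfK (expf_neq0 j x0))); rewrite -exprD subnK.
suff qp : q = signature l *: p.
  by rewrite -coefZ -qp coef_poly ltnS leN.
apply: poly_eq_nat => i; set x := _%:R.
have x0 : x != 0 by rewrite pnatr_eq0.
have x1 : 1 + x != 0 by rewrite -[1]/(1%:R) -natrD pnatr_eq0.
apply: (mulfI x1); rewrite hornerZ mulrCA.
have -> : (1 + x) * p.[x] = (cycle_poly l).[x] by rewrite -pl !hornerE.
have x1E : 1 + x = x * (1 + x^-1) by rewrite mulrDr mulr1 divff // addrC.
by rewrite -cycle_poly_inv // -pl lN qE // !hornerE exprS x1E; congr (_ * _); exact: mulrAC.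
Qed.

(** Dividing the factor of the first part [i] by 1 + X leaves a sum equal to [i] at -1, while the
    factor of any further part vanishes there. *)
Lemma hook_poly_N1 l N p : 0%N \notin l -> sumn l = N.+1 ->
  (1 + 'X) * p = cycle_poly l -> p.[-1] = (N.+1)%:R * (l == [:: N.+1])%:R.
Proof.
case: l => [|i l]; first by [].
move=> l0 lN /cycle_poly_factor ->; rewrite hornerM horner_sum.
rewrite (eq_bigr (fun=> 1)); last first.
  by move=> j _; rewrite horner_exp hornerN hornerX opprK expr1n.
rewrite sumr_const card_ord; case: l l0 lN => [|j l] l0 /= lN.
  by rewrite /cycle_poly big_nil hornerC -lN addn0 eqxx.
have root_j : (1 - (- 'X) ^+ j).[-1] = 0 :> rat by rewrite !hornerE opprK expr1n subrr.
rewrite cycle_poly_cons hornerM root_j mul0r mulr0.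
by rewrite (_ : _ == _ = false) ?mulr0 //; apply/eqP=> -[].
Qed.

(* The indicator function of the n-cycles is (1/n) sum_k (-1)^k chi_k. *)
Lemma factorisation_count n (mu : seq nat) p (s : 'S_n.+1) :
  (1 + 'X) * p = cycle_poly mu ->
  (n.+1)%:R * #|[set ab : 'S_n.+1 * 'S_n.+1 |
      [&& cycle_type ab.1 == [:: n.+1], cycle_type ab.2 == mu
        & (ab.1 * ab.2)%g == s]]|%:R =
  #|[set b : 'S_n.+1 | cycle_type b == mu]|%:R *
    \sum_(k < n.+1) (-1) ^+ k * p`_k * hook_char k s / 'C(n, k)%:R.
Proof.
move=> pmu; set B := [set b : 'S_n.+1 | _].
have hookB k b : b \in B -> hook_char k b = p`_k.
  rewrite inE => /eqP bmu; suff -> : p = hook_poly b by rewrite coef_hook_poly.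
  by apply: (mulfI oneX_neq0); rewrite mul_hook_poly bmu.
have BJ t b : ((b ^ t)%g \in B) = (b \in B) by rewrite !inE cycle_type_conj.
have sumB k : (k < n.+1)%N ->
    \sum_(b in B) hook_char k (b * s)%g = #|B|%:R * p`_k * hook_char k s / 'C(n, k)%:R.
  rewrite ltnS => lekn; have C0 : 'C(n, k)%:R != 0 :> rat by rewrite pnatr_eq0 -lt0n bin_gt0.
  apply: (canRL (mulfK C0)).
  have F0 : (n.+1)`!%:R != 0 :> rat by rewrite pnatr_eq0 -lt0n fact_gt0.
  apply: (mulfI F0).
  (* [B] is stable under conjugation, so its sum may be averaged over the group, which brings in the
     functional equation. *)
  transitivity (\sum_(b in B) (\sum_t hook_char k ((b ^ t) * s)%g) * 'C(n, k)%:R).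
    rewrite -mulr_suml mulrA; congr (_ * _); rewrite [RHS]exchange_big /=.
    rewrite [RHS](eq_bigr (fun=> \sum_(b in B) hook_char k (b * s)%g)).
      by rewrite sumr_const cardT -cardE card_Sn mulr_natl.
    move=> t _; rewrite [RHS](reindex_inj (conjg_inj t)) /=.
    by apply: eq_bigl => b; rewrite BJ.
  rewrite (eq_bigr (fun=> (n.+1)`!%:R * p`_k * hook_char k s)).
    by rewrite sumr_const -mulr_natl; ring.
  by move=> b bB; rewrite hook_char_functional hookB.
have -> : #|[set ab : 'S_n.+1 * 'S_n.+1 | [&& cycle_type ab.1 == [:: n.+1],
    cycle_type ab.2 == mu & (ab.1 * ab.2)%g == s]]|
    = (\sum_(b in B) (cycle_type (b * s)%g == [:: n.+1]))%N.
  (* The second factor determines the first, [s * b^-1]. Replacing [b] by its inverse, of the same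
     type, and conjugating gives [b * s]. *)
  rewrite -sum1_card (reindex_onto (fun b => (s * b^-1, b))%g snd) => [|[x y]]; last first.
    by rewrite inE => /and3P[_ _ /eqP <-]; rewrite mulgK.
  rewrite big_mkcond [RHS]big_mkcond (reindex_inj invg_inj) /=; apply: eq_bigr => b _.
  rewrite !inE invgK cycle_typeV eqxx andbT mulgK eqxx andbT.
  rewrite -(cycle_type_conj (b * s)%g b) conjgE mulgA mulKg.
  by case: (cycle_type b == mu); case: eqP.
rewrite natr_sum mulr_sumr.
rewrite (eq_bigr (fun b => \sum_(k < n.+1) (-1) ^+ k * hook_char k (b * s)%g)).
  rewrite exchange_big mulr_sumr /=; apply: eq_bigr => k _.
  by rewrite -mulr_sumr sumB //; ring.
move=> b _; rewrite -(@hook_poly_N1 _ n (hook_poly (b * s)%g)) ?cycle_type_gt0 //.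
- rewrite horner_poly; apply: eq_bigr => k _; exact: mulrC.
- by rewrite sumn_cycle_type card_ord.
- exact: mul_hook_poly.
Qed.

(** * Size of a class with one distinguished cycle *)

Lemma perm_enumU1 (T : finType) (x : T) (A : {set T}) :
  x \notin A -> perm_eq (enum (x |: A)) (x :: enum A).
Proof.
move=> xA; apply: uniq_perm; rewrite /= ?enum_uniq ?mem_enum ?xA //.
by move=> y; rewrite mem_enum !inE mem_enum.
Qed.

Lemma cycle_type_lift_perm n (x : 'I_n.+1) (s : 'S_n) :
  perm_eq (cycle_type (lift_perm x x s)) (1%N :: cycle_type s).
Proof.
set t := lift_perm x x s; have tl j : t (lift x j) = lift x (s j) by rewrite lift_perm_lift.
have tx : t x = x by rewrite lift_perm_id.
have xN (C : {set 'I_n}) : x \notin lift x @: C.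
  by apply/imsetP=> -[j _ xj]; have := neq_lift x j; rewrite -xj eqxx.
have tP : porbits t = [set x] |: [set lift x @: (C : {set 'I_n}) | C in porbits s].
  apply/setP=> C; apply/imsetP/setU1P=> [[y _ ->] | ].
    case: (unliftP x y) => [j | ] ->; last by left; rewrite porbit_fix.
    by right; rewrite (porbit_morph _ tl) imset_f // imset_f.
  case=> [-> | /imsetP[_ /imsetP[j _ ->] ->]]; first by exists x; rewrite ?porbit_fix.
  by exists (lift x j); rewrite // (porbit_morph _ tl).
apply: perm_trans (perm_cycle_type _) _; rewrite tP.
have nP : [set x] \notin [set lift x @: (C : {set 'I_n}) | C in porbits s].
  by apply/imsetP=> -[C _ xC]; have := xN C; rewrite -xC set11.
apply: perm_trans (perm_map _ (perm_enumU1 nP)) _; rewrite /= cards1 perm_cons.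
apply: perm_trans (perm_map _ (perm_enum_imset _ _)) _.
  by apply: imset_inj; apply: lift_inj.
rewrite -map_comp (eq_map (g := fun C : {set 'I_n} => #|C|)).
  by rewrite perm_sym perm_cycle_type.
by move=> C /=; rewrite card_imset //; apply: lift_inj.
Qed.

Lemma cycle_type_insert (T : finType) (s : {perm T}) x y : s x = x -> y != x ->
  exists r, perm_eq (cycle_type s) [:: 1%N, #|porbit s y| & r] /\
    perm_eq (cycle_type (tperm x y * s)%g) (#|porbit s y|.+1 :: r).
Proof.
move=> sx nyx; have xNy : x \notin porbit s y by rewrite porbit_sym porbit_fix // inE.
set Q := porbits s :\ [set x] :\ porbit s y.
exists [seq #|C| | C : {set T} <- enum Q]; split.
  apply: perm_trans (perm_cycle_type _) _.
  have -> : porbits s = [set x] |: (porbit s y |: Q).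
    rewrite setD1K ?setD1K //; first by rewrite -(porbit_fix sx) imset_f.
    rewrite !inE imset_f // andbT; apply: contraNneq xNy => ->; exact: set11.
  apply: perm_trans (perm_map _ (perm_enumU1 _)) _.
    rewrite !inE eqxx !andbF orbF eq_sym.
    by apply: contraNneq xNy => ->; exact: set11.
  rewrite /= cards1 perm_cons; apply: perm_trans (perm_map _ (perm_enumU1 _)) _ => //.
  by rewrite !inE eqxx.
apply: perm_trans (perm_cycle_type _) _; rewrite porbits_insert //.
apply: perm_trans (perm_map _ (perm_enumU1 _)) _; last by rewrite /= cardsU1 xNy.
rewrite !inE; apply/negP=> /and3P[_ nx /imsetP[z _ xz]]; case/negP: nx.
have : x \in porbit s z by rewrite -xz setU11.
by rewrite -eq_porbit_mem => /eqP zx; rewrite xz -zx porbit_fix.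
Qed.

Lemma lift_perm_fix n (x : 'I_n.+1) (s : 'S_n.+1) :
  s x = x -> exists t, s = lift_perm x x t.
Proof.
move=> sx; have liftP j : exists k, s (lift x j) == lift x k.
  have : x != s (lift x j) by rewrite -{1}sx (inj_eq perm_inj) neq_lift.
  by case/unlift_some=> k -> _; exists k.
pose g j := xchoose (liftP j).
have gE j : s (lift x j) = lift x (g j) by apply/eqP/(xchooseP (liftP j)).
have injg : injective g.
  by move=> i j gij; apply: (@lift_inj _ x); apply: (@perm_inj _ s); rewrite !gE gij.
exists (perm injg); apply/permP=> y; case: (unliftP x y) => [j | ] ->.
  by rewrite lift_perm_lift permE gE.
by rewrite lift_perm_id.
Qed.

(** Marking a point on a cycle of length [l] makes the count transform simply when that cycle
    grows. *)
Definition pointed_class n l (r : seq nat) : {set 'S_n * 'I_n} :=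
  [set sx | (#|porbit sx.1 sx.2| == l) && perm_eq (cycle_type sx.1) (l :: r)].

(** The marked point [x] can be any of the [n.+1] points. Cutting it out of its cycle and marking
    its predecessor, distinct from [x] because [l > 0], inverts the map [f x]. *)
Lemma card_pointed_classS n l r : (0 < l)%N ->
  #|pointed_class n.+1 l.+1 r| = (n.+1 * #|pointed_class n l r|)%N.
Proof.
move=> l0; pose f (x : 'I_n.+1) (sj : 'S_n * 'I_n) : 'S_n.+1 :=
    (tperm x (lift x sj.2) * lift_perm x x sj.1)%g.
have fx x sj : f x sj (lift x sj.2) = x by rewrite permM tpermR lift_perm_id.
have injf x : injective (f x).
  move=> [s i] [t j] fst; have ij : i = j.
    by apply: (@lift_inj _ x); apply: (@perm_inj _ (f x (s, i))); rewrite {2}fst !fx.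
  rewrite -ij in fst *; congr (_, _); move/mulgI/permP: fst => fst.
  apply/permP=> k; apply: (@lift_inj _ x).
  by rewrite -!(lift_perm_lift x x) fst.
have fP x sj : (#|porbit (f x sj) x| == l.+1)
      && perm_eq (cycle_type (f x sj)) (l.+1 :: r) = (sj \in pointed_class n l r).
  case: sj => s j; rewrite inE /=; set y := lift x j.
  have lx : lift_perm x x s x = x by rewrite lift_perm_id.
  have nyx : y != x by rewrite eq_sym neq_lift.
  have [r' [sr tr]] := cycle_type_insert lx nyx.
  have oE : porbit (lift_perm x x s) y = lift x @: porbit s j.
    by apply: porbit_morph => z; rewrite lift_perm_lift.
  have cE : #|porbit (lift_perm x x s) y| = #|porbit s j|.
    by rewrite oE card_imset //; apply: lift_inj.
  have -> : porbit (f x (s, j)) x = x |: porbit (lift_perm x x s) y.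
    rewrite -porbit_insert //; apply/eqP; rewrite eq_porbit_mem porbit_insert //.
    exact: setU11.
  rewrite cardsU1 (_ : x \notin _); last by rewrite porbit_sym porbit_fix // inE.
  rewrite cE add1n eqSS; case: eqP => //= sl.
  rewrite cE sl in sr tr.
  have := cycle_type_lift_perm x s; rewrite perm_sym => /perm_trans/(_ sr).
  rewrite perm_cons => sr'; rewrite (permPl tr) (permPl sr') !perm_cons.
  by [].
have fonto x (s : 'S_n.+1) : #|porbit s x| == l.+1 -> exists sj, s = f x sj.
  move=> sl; have nsx : (s^-1)%g x != x.
    apply/eqP=> sx; move: sl; rewrite porbit_fix ?cards1; last by rewrite -{1}sx permKV.
    by rewrite eqSS eq_sym -leqn0 leqNgt l0.
  rewrite eq_sym in nsx; have [j xj _] := unlift_some nsx.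
  have [t tE] : exists t, (tperm x (lift x j) * s)%g = lift_perm x x t.
    by apply: lift_perm_fix; rewrite permM tpermL -xj permKV.
  by exists (t, j); rewrite /f /= -tE mulgA tperm2 mul1g.
rewrite -sum1_card.
rewrite (eq_bigl (fun sx : 'S_n.+1 * 'I_n.+1 =>
  xpredT sx.1 && ((sx.1, sx.2) \in pointed_class n.+1 l.+1 r))); last by case.
rewrite -(pair_big_dep xpredT
  (fun s x => (s, x) \in pointed_class n.+1 l.+1 r) (fun _ _ => 1%N)) /=.
rewrite (exchange_big_dep xpredT) //= (eq_bigr (fun=> #|pointed_class n l r|)).
  by rewrite sum_nat_const card_ord.
move=> x _; rewrite sum1_card -(card_imset (mem (pointed_class n l r)) (injf x)).
apply: eq_card => s; transitivity ((s, x) \in pointed_class n.+1 l.+1 r); first by [].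
rewrite inE /=.
apply/andP/imsetP=> [[sl sr] | [sj sjP ->]]; last by apply/andP; rewrite fP.
have [sj sE] := fonto x s sl; exists sj => //.
by rewrite -(fP x) -sE sl.
Qed.

(** As [l] is not in [r], there is a single cycle of length [l], hence [l] ways to mark a point. *)
Lemma card_pointed_class n l r : l \notin r ->
  #|pointed_class n l r| =
    (l * #|[set s : 'S_n | perm_eq (cycle_type s) (l :: r)]|)%N.
Proof.
move=> lr; rewrite -sum1_card.
rewrite (eq_bigl (fun sx : 'S_n * 'I_n => perm_eq (cycle_type sx.1) (l :: r)
  && (#|porbit sx.1 sx.2| == l))); last by move=> sx; rewrite inE andbC.
rewrite -(pair_big_dep (fun s : 'S_n => perm_eq (cycle_type s) (l :: r))
  (fun s x => #|porbit s x| == l) (fun _ _ => 1%N)) /=.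
rewrite (eq_bigr (fun=> l)); first by rewrite sum_nat_const cardsE mulnC.
move=> s sr; rewrite big_mkcond (partition_big (porbit s) (mem (porbits s))) /=; last first.
  by move=> x _; apply: imset_f.
rewrite (eq_bigr (fun C : {set 'I_n} => #|C| * (#|C| == l))%N); last first.
  move=> C /imsetP[y _ ->]; rewrite (eq_bigr (fun=> (#|porbit s y| == l) : nat)).
    rewrite sum_nat_const; congr (_ * _)%N; apply: eq_card => x.
    by rewrite -eq_porbit_mem.
  by move=> x /eqP ->; case: eqP.
rewrite -(big_cycle_type _ s (fun i => i * (i == l))%N) (perm_big _ sr) big_cons eqxx muln1.
rewrite -[RHS]addn0; congr (_ + _)%N; apply: big1_seq => i /andP[_ ir].
by case: eqP ir lr => [-> -> // | _ _ _]; rewrite muln0.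
Qed.

(** When the long cycle grows by one, the pointed count and the factorial acquire the same factor,
    so the ratio keeps its value at [n = a.+1]. *)
Lemma card_class_ratio n a r : (a < n)%N -> (n - a)%N \notin r ->
  (#|[set s : 'S_n | perm_eq (cycle_type s) ((n - a)%N :: r)]| * (n - a))%:R / n`!%:R
    = #|pointed_class a.+1 1 r|%:R / (a.+1)`!%:R :> rat.
Proof.
move=> ltan nar; rewrite mulnC -card_pointed_class //.
have [b ->] : exists b, n = (a + b.+1)%N by exists (n - a).-1; lia.
rewrite addKn; elim: b => [|b IHb]; first by rewrite addn1.
rewrite -IHb addnS card_pointed_classS // factS !natrM -mulf_div divff ?mul1r //.
by rewrite pnatr_eq0.
Qed.

(** * Polynomial dependence on the size and the multiplicities *)

(* Functions of [n] and of a partition [l] that are polynomial in the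
   coordinates [size_mult] of the theorem. *)
Definition polyfun a (F : nat -> seq nat -> rat) : Prop :=
  exists Z : {mpoly rat[a]}, forall n l, 0%N \notin l -> F n l = Z.@[@size_mult n a l].

Lemma polyfun_ext a F G : (forall n l, 0%N \notin l -> F n l = G n l) ->
  polyfun a F -> polyfun a G.
Proof. by move=> FG [Z ZP]; exists Z => n l l0; rewrite -FG ?ZP. Qed.

Lemma polyfun_const a c : polyfun a (fun _ _ => c).
Proof. by exists c%:MP => n l _; rewrite mevalC. Qed.

Lemma polyfunD a F G : polyfun a F -> polyfun a G -> polyfun a (fun n l => F n l + G n l).
Proof. by move=> [Y YP] [Z ZP]; exists (Y + Z) => n l l0; rewrite mevalD YP ?ZP. Qed.

Lemma polyfunM a F G : polyfun a F -> polyfun a G -> polyfun a (fun n l => F n l * G n l).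
Proof. by move=> [Y YP] [Z ZP]; exists (Y * Z) => n l l0; rewrite mevalM YP ?ZP. Qed.

Lemma polyfunB a F G : polyfun a F -> polyfun a G -> polyfun a (fun n l => F n l - G n l).
Proof. by move=> [Y YP] [Z ZP]; exists (Y - Z) => n l l0; rewrite mevalB YP ?ZP. Qed.

Lemma polyfun_sum a (I : Type) (r : seq I) (P : pred I) (F : I -> nat -> seq nat -> rat) :
  (forall i, P i -> polyfun a (F i)) -> polyfun a (fun n l => \sum_(i <- r | P i) F i n l).
Proof.
move=> FP; elim: r => [|i r IHr].
  by apply: polyfun_ext (polyfun_const a 0) => n l _; rewrite big_nil.
case Pi: (P i); last by apply: polyfun_ext IHr => n l _; rewrite big_cons Pi.
by apply: polyfun_ext (polyfunD (FP i Pi) IHr) => n l _; rewrite big_cons Pi.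
Qed.

Lemma polyfun_prod a (I : Type) (r : seq I) (P : pred I) (F : I -> nat -> seq nat -> rat) :
  (forall i, P i -> polyfun a (F i)) -> polyfun a (fun n l => \prod_(i <- r | P i) F i n l).
Proof.
move=> FP; elim: r => [|i r IHr].
  by apply: polyfun_ext (polyfun_const a 1) => n l _; rewrite big_nil.
case Pi: (P i); last by apply: polyfun_ext IHr => n l _; rewrite big_cons Pi.
by apply: polyfun_ext (polyfunM (FP i Pi) IHr) => n l _; rewrite big_cons Pi.
Qed.

Lemma polyfun_size a : (0 < a)%N -> polyfun a (fun n _ => n%:R).
Proof. by move=> a0; exists 'X_(Ordinal a0) => n l _; rewrite mevalXU. Qed.

Lemma polyfun_count a i : (0 < i < a)%N -> polyfun a (fun _ l => (count_mem i l)%:R).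
Proof.
case/andP=> i0 ia; exists 'X_(Ordinal ia) => n l _; rewrite mevalXU /size_mult /=.
by rewrite eqn0Ngt i0.
Qed.

Lemma ffact_rat m k : (m ^_ k)%:R = \prod_(i < k) (m%:R - i%:R) :> rat.
Proof.
elim: k => [|k IHk]; first by rewrite big_ord0.
rewrite ffactnSr big_ord_recr /= -IHk natrM.
have [lekm | ltmk] := leqP k m; first by rewrite natrB.
by rewrite ffact_small // !mul0r.
Qed.

Lemma polyfun_bin a i j : (0 < i < a)%N -> polyfun a (fun _ l => 'C(count_mem i l, j)%:R).
Proof.
move=> ia.
apply: (@polyfun_ext _ (fun _ l => j`!%:R^-1 * \prod_(t < j) ((count_mem i l)%:R - t%:R))).
  move=> _ l _; rewrite -ffact_rat -bin_ffact natrM mulrC mulfK //.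
  by rewrite pnatr_eq0 -lt0n fact_gt0.
apply: polyfunM (polyfun_const _ _) _; apply: polyfun_prod => t _.
exact: polyfunB (polyfun_count ia) (polyfun_const _ _).
Qed.

Definition polyfun_coefs a (F : nat -> seq nat -> {poly rat}) : Prop :=
  forall k, (k < a)%N -> polyfun a (fun n l => (F n l)`_k).

Lemma polyfun_coefsM a F G : polyfun_coefs a F -> polyfun_coefs a G ->
  polyfun_coefs a (fun n l => F n l * G n l).
Proof.
move=> FP GP k ka.
apply: (@polyfun_ext _ (fun n l => \sum_(j < k.+1) (F n l)`_j * (G n l)`_(k - j))).
  by move=> n l _; rewrite coefM.
apply: polyfun_sum => j _; apply: polyfunM; first by apply: FP; have := ltn_ord j; lia.
by apply: GP; lia.
Qed.

Lemma polyfun_coefs_prod a (I : Type) (r : seq I) (P : pred I) F :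
  (forall i, P i -> polyfun_coefs a (F i)) ->
  polyfun_coefs a (fun n l => \prod_(i <- r | P i) F i n l).
Proof.
move=> FP; elim: r => [|i r IHr] k ka.
  by apply: polyfun_ext (polyfun_const a (1 : {poly rat})`_k) => n l _; rewrite big_nil.
case Pi: (P i); last by apply: polyfun_ext (IHr k ka) => n l _; rewrite big_cons Pi.
by apply: polyfun_ext (polyfun_coefsM (FP i Pi) IHr ka) => n l _; rewrite big_cons Pi.
Qed.

Lemma sum_ord_trunc (V : nmodType) m d (G : nat -> V) :
  (forall j, (m <= j)%N -> G j = 0) -> \sum_(j < m + d) G j = \sum_(j < m) G j.
Proof.
move=> G0; rewrite big_split_ord /= [X in _ + X]big1 ?addr0 // => j _.
by rewrite G0 // leq_addr.
Qed.

Lemma coef_exp_oppX (c i j k : nat) : (0 < i)%N -> (k < j)%N ->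
  ((- (- 'X) ^+ i) ^+ j : {poly rat})`_k = 0.
Proof.
move=> i0 kj; rewrite exprNn -exprM [(- 'X) ^+ _]exprNn mulrA.
rewrite coefMXn (leq_trans kj) //.
by rewrite leq_pmull.
Qed.

(** The binomial expansion has a number of terms that depends on [l], but as [i > 0] the terms with
    [j >= a] do not reach degree [k < a]. The sum thus has a fixed range, and each binomial
    coefficient is polynomial in the multiplicity. *)
Lemma polyfun_coefs_factor a i : (0 < i < a)%N ->
  polyfun_coefs a (fun _ l => (1 - (- 'X) ^+ i) ^+ count_mem i l).
Proof.
move=> ia k ka; have i0 : (0 < i)%N by case/andP: ia.
apply: (@polyfun_ext _ (fun _ l => \sum_(j < a)
    'C(count_mem i l, j)%:R * ((- (- 'X) ^+ i) ^+ j : {poly rat})`_k)).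
  move=> _ l _; set c := count_mem i l; rewrite exprDn coef_sum.
  pose G j : rat := 'C(c, j)%:R * ((- (- 'X) ^+ i) ^+ j : {poly rat})`_k.
  transitivity (\sum_(j < c.+1) G j); last first.
    by apply: eq_bigr => j _; rewrite expr1n mul1r coefMn -mulr_natl.
  rewrite -(@sum_ord_trunc _ a c.+1 G) => [|j aj]; last first.
    by rewrite /G coef_exp_oppX ?mulr0 //; lia.
  rewrite addnC (@sum_ord_trunc _ c.+1 a G) // => j cj.
  by rewrite /G bin_small ?mul0r.
apply: polyfun_sum => j _; apply: polyfunM (polyfun_const _ _); exact: polyfun_bin.
Qed.

Lemma coefM_congr a (p p' q q' : {poly rat}) :
  (forall k, (k < a)%N -> p`_k = p'`_k) -> (forall k, (k < a)%N -> q`_k = q'`_k) ->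
  forall k, (k < a)%N -> (p * q)`_k = (p' * q')`_k.
Proof.
move=> pp' qq' k ka; rewrite !coefM; apply: eq_bigr => j _; have := ltn_ord j => jk.
by rewrite pp' ?qq' //; lia.
Qed.

(** A part of size at least [a] has a factor congruent to 1 modulo X^a. *)
Lemma coef_cycle_poly_trunc a l k : 0%N \notin l -> (k < a)%N ->
  (cycle_poly l)`_k =
  (\prod_(i < a | (0 < i)%N) (1 - (- 'X) ^+ i) ^+ count_mem (val i) l : {poly rat})`_k.
Proof.
elim: l k => [|j l IHl] k.
  by rewrite /cycle_poly big_nil big1 // => i _; rewrite /= expr0.
rewrite inE negb_or eq_sym -lt0n => /andP[j0 l0] ka; rewrite cycle_poly_cons.
under eq_bigr => i _ do rewrite /= exprD.
rewrite big_split /=; apply: (@coefM_congr a) => // {k ka}; last by move=> k; apply: IHl.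
move=> k ka; have [ja | aj] := ltnP j a.
  rewrite (bigD1 (Ordinal ja)) //= eqxx expr1 big1 ?mulr1 // => i /andP[_ ni].
  by rewrite (_ : (j == i) = false) ?expr0 //; apply: contraNF ni => /eqP ji; apply/eqP/val_inj.
rewrite big1 => [|i _]; last first.
  by rewrite (_ : (j == i) = false) ?expr0 //; apply/eqP=> ji; have := ltn_ord i; lia.
by rewrite coefB exprNn coefMXn (leq_trans ka aj) subr0.
Qed.

(** The coefficients of the power series [cycle_poly l] divided by 1 + X. They are defined from [l]
    alone, without a permutation, as [polyfun] requires. *)
Fixpoint hook_coef k l : rat :=
  if k is k'.+1 then (cycle_poly l)`_k - hook_coef k' l else (cycle_poly l)`_0.

Lemma hook_char_coef n k (s : 'S_n.+1) : hook_char k s = hook_coef k (cycle_type s).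
Proof.
elim: k => [|k IHk] /=; first by rewrite coef_cycle_poly ext_char0.
by rewrite coef_cycle_poly ext_charS -IHk addrK.
Qed.

Lemma polyfun_hook_coef a k : (k < a)%N -> polyfun a (fun _ l => hook_coef k l).
Proof.
have cP j : (j < a)%N -> polyfun a (fun _ l => (cycle_poly l)`_j).
  move=> ja; apply: (@polyfun_ext _ (fun _ l =>
    (\prod_(i < a | (0 < i)%N) (1 - (- 'X) ^+ i) ^+ count_mem (val i) l : {poly rat})`_j)).
    by move=> _ l l0; rewrite -coef_cycle_poly_trunc.
  apply: (@polyfun_coefs_prod a _ (index_enum 'I_a) (fun i => (0 < i)%N)
    (fun i _ l => (1 - (- 'X) ^+ i) ^+ count_mem (val i) l)) => // i i0.
  by apply: polyfun_coefs_factor; rewrite i0 /=.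
elim: k => [|k IHk] ka /=; first exact: cP.
by apply: polyfunB; [apply: cP | apply: IHk; apply: ltnW].
Qed.

(** * Folding the character sum and conclusion *)

(** [P] lives in degrees below [a] and its shifted copy in degrees [b] to [m]. Reversing the second
    range sends the index [k] to [m - k], and the two symmetries turn it into a multiple of the
    first. *)
Lemma hook_sum_fold a b m (P : {poly rat}) (f : nat -> rat) d e :
  (a + b = m.+1)%N ->
  (forall k, (a <= k)%N -> P`_k = 0) ->
  (forall k, (k < a)%N -> P`_(a - k.+1) = d * P`_k) ->
  (forall k, (k <= m)%N -> f (m - k)%N = e * f k) ->
  \sum_(k < m.+1) (-1) ^+ k * ((1 - (- 'X) ^+ b) * P)`_k * f k =
  (1 + (-1) ^+ a * d * e) * \sum_(k < a) (-1) ^+ k * P`_k * f k.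
Proof.
move=> abm P0 Psym fsym.
have coefE k : ((1 - (- 'X) ^+ b) * P)`_k =
    P`_k - (-1) ^+ b * (if (k < b)%N then 0 else P`_(k - b)).
  by rewrite mulrBl mul1r coefB exprNX -mulrA coefCM coefXnM.
have sumE (G : nat -> rat) : \sum_(k < m.+1) G k = \sum_(k < a + b) G k by rewrite abm.
under eq_bigr => k _ do rewrite coefE mulrBr mulrBl.
rewrite big_split /= sumrN mulrDl mul1r; congr (_ + _).
  pose G k := (-1) ^+ k * P`_k * f k.
  by rewrite (sumE G) (@sum_ord_trunc _ a b G) // /G => k ak; rewrite P0 // mulr0 mul0r.
rewrite (sumE (fun k => (-1) ^+ k * ((-1) ^+ b * (if (k < b)%N then 0 else P`_(k - b))) * f k)).
rewrite addnC big_split_ord /= big1 ?add0r => [|k _]; last by rewrite ltn_ord !mulr0 mul0r.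
rewrite (reindex_inj rev_ord_inj) /= -sumrN mulr_sumr; apply: eq_bigr => k _.
have ka := ltn_ord k.
rewrite ltnNge leq_addr /= addKn Psym // exprD (_ : (b + (a - k.+1) = m - k)%N); last by lia.
rewrite fsym; last by lia.
(* The minus sign of 1 - (-X)^b is absorbed by a = (a - k - 1) + k + 1, and the two signs
   [(-1) ^+ b] cancel. *)
have -> : (-1) ^+ a = - ((-1) ^+ (a - k.+1) * (-1) ^+ k) :> rat.
  by rewrite -exprD -[RHS]mulN1r -exprS; congr (_ ^+ _); lia.
have b2 : (-1) ^+ b * (-1) ^+ b = 1 :> rat by rewrite -expr2 sqrr_sign.
have k2 : (-1) ^+ k * (-1) ^+ k = 1 :> rat by rewrite -expr2 sqrr_sign.
set x := (-1) ^+ (a - k.+1); set y := (-1) ^+ b in b2 *; set z := (-1) ^+ k in k2 *.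
transitivity (- (y * y) * (x * d * P`_k * e * f k)); first by ring.
by rewrite b2 -k2; ring.
Qed.

Lemma fact_addn b j : (b + j)`!%:R = b`!%:R * \prod_(i < j) (b%:R + 1 + i%:R) :> rat.
Proof.
elim: j => [|j IHj]; first by rewrite addn0 big_ord0 mulr1.
rewrite addnS factS natrM IHj big_ord_recr /= mulrC -mulrA; congr (_ * (_ * _)).
by rewrite -addn1 !natrD addrAC.
Qed.

Lemma perm_part_union (T : finType) (s : {perm T}) l r :
  (cycle_type s == part_union [:: l] r) = perm_eq (cycle_type s) (l :: r).
Proof.
by rewrite (permPl (perm_cycle_type s)); apply/eqP/sort_geqP.
Qed.

(** The [k]-th term of the folded sum once the factorials of 1 / C(n-1, k) are split: the product is
    (n-1-k)! / (n-a)!, a polynomial in [n]. *)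
Definition nu_weight a (P : {poly rat}) k (n : nat) (l : seq nat) : rat :=
  (-1) ^+ k * P`_k * k`!%:R *
  \prod_(i < a - k.+1) (n%:R - a%:R + 1 + i%:R) * hook_coef k l.

(** [factorisation_count] applied to (1 - (-X)^(n-a)) [P], then folded. Of (n-a)!, the factor n-a
    joins the class size and (n-a-1)! stays in front. *)
Lemma nu_formula a rho (P : {poly rat}) n (s : 'S_n) :
  (a < n)%N -> is_partition a rho -> (0 < a)%N -> (1 + 'X) * P = cycle_poly rho ->
  (nu a rho s)%:R =
    (1 + (-1) ^+ a * signature rho * signature (cycle_type s)) * (n - a - 1)`!%:R *
    ((#|[set b : 'S_n | perm_eq (cycle_type b) ((n - a)%N :: rho)]| * (n - a))%:R / n`!%:R *
     \sum_(k < a) nu_weight a P k n (cycle_type s)).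
Proof.
case: n s => // m s ltam /and3P[_ rho0 /eqP sum_rho] a0 Prho; pose b := (m - a)%N.
have bE : (m.+1 - a = b.+1)%N by rewrite /b subSn.
have abm : (a + b.+1 = m.+1)%N by rewrite -bE subnKC // ltnW.
rewrite bE subSS subn0.
set p := (1 - (- 'X) ^+ b.+1) * P.
have pE : (1 + 'X) * p = cycle_poly (part_union [:: b.+1] rho).
  by rewrite mulrCA Prho -cycle_poly_cons /cycle_poly; apply: perm_big; rewrite perm_sym perm_sort.
have := factorisation_count s pE.
rewrite (_ : #|[set ab | _]| = nu a rho s); last by rewrite /nu bE.
set B := [set _ | _]; set B' := [set _ | _].
have -> : B = B' by apply/setP=> t; rewrite !inE perm_part_union.
have n0 : m.+1%:R != 0 :> rat by rewrite pnatr_eq0.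
move=> nuE; apply: (mulfI n0); rewrite nuE.
under eq_bigr => k _ do rewrite -mulrA.
rewrite (@hook_sum_fold a b.+1 m P (fun k => hook_char k s / 'C(m, k)%:R)
  (signature rho) (signature (cycle_type s))) //; first last.
- move=> k lekm; rewrite bin_sub // -!coef_hook_poly mulrA; congr (_ / _).
  apply: (@hook_poly_sym _ m); rewrite ?cycle_type_gt0 ?mul_hook_poly //.
  by rewrite sumn_cycle_type card_ord.
- move=> k ka; have -> : (a - k.+1 = a.-1 - k)%N by lia.
  by apply: (@hook_poly_sym _ a.-1); rewrite ?sum_rho ?prednK //; lia.
- move=> k ak; apply: nth_default; apply: leq_trans ak.
  by rewrite -sum_rho; apply: size_hook_poly.
rewrite mulrCA -[RHS]mulrCA -!mulrA; congr (_ * _).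
rewrite !mulr_sumr; apply: eq_bigr => k _; have ka := ltn_ord k.
have km : (k <= m)%N by lia.
have mb : m%:R = b%:R + a%:R :> rat by rewrite -natrD; congr _%:R; lia.
have bin0 : 'C(m, k)%:R != 0 :> rat by rewrite pnatr_eq0 -lt0n bin_gt0.
have fact0 j : j`!%:R != 0 :> rat by rewrite pnatr_eq0 -lt0n fact_gt0.
have binE : 'C(m, k)%:R^-1 = k`!%:R * (m - k)`!%:R / m`!%:R :> rat.
  by apply: (mulfI bin0); rewrite divff // mulrA -!natrM bin_fact ?divff.
rewrite binE (_ : (m - k = b.+1 + (a - k.+1))%N); last by lia.
rewrite fact_addn /nu_weight hook_char_coef !factS !natrM.
have -> : \prod_(i < a - k.+1) (m.+1%:R - a%:R + 1 + i%:R) =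
    \prod_(i < a - k.+1) (b.+1%:R + 1 + i%:R) :> rat.
  by apply: eq_bigr => i _; rewrite -[m.+1]addn1 -[b.+1]addn1 !natrD mb; ring.
move: (\prod_(_ < _) _) => x; have := fact0 m.
by move=> m0; field; rewrite m0 nat1r n0.
Qed.

(* The first conjunct makes Z depend on rho only.  It excludes the n for which
   n - a is a part of rho, where no such uniform Z need exist: for rho = (1),
   nu is 2 (n-2)! on odd permutations when n > 2, but 1 when n = 2.  The second
   conjunct covers every n > a, with n fixed before Z. *)
Theorem theorem1p1 (a : nat) (rho : seq nat) :
  (0 < a)%N -> is_partition a rho ->
  (exists Z : {mpoly rat[a]},
     forall n : nat, (a < n)%N -> (n - a)%N \notin rho ->
     forall lambda : seq nat, is_partition n lambda ->
     forall s : 'S_n, cycle_type s = lambda ->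
       (nu a rho s)%:R =
         (1 + (-1) ^+ a * signature rho * signature lambda)
           * (n - a - 1)`!%:R * Z.@[@size_mult n a lambda])
  /\
  (forall n : nat, (a < n)%N ->
   exists Z : {mpoly rat[a]},
     forall lambda : seq nat, is_partition n lambda ->
     forall s : 'S_n, cycle_type s = lambda ->
       (nu a rho s)%:R =
         (1 + (-1) ^+ a * signature rho * signature lambda)
           * (n - a - 1)`!%:R * Z.@[@size_mult n a lambda]).
Proof.
move=> a0 rhoP; have /and3P[_ rho0 /eqP sum_rho] := rhoP.
(* Since [a > 0], [rho] has a part, whose factor is divisible by 1 + X. *)
have [P Prho] : exists P, (1 + 'X) * P = cycle_poly rho.
  case: (rho) sum_rho => [/= ae | i r _]; first by rewrite -ae in a0.
  by exists ((\sum_(j < i) (- 'X) ^+ j) * cycle_poly r); rewrite mulrA -oneX_factor cycle_poly_cons.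
have [Z ZP] : polyfun a (fun n l => \sum_(k < a) nu_weight a P k n l).
  apply: polyfun_sum => k _; apply: polyfunM; last exact: polyfun_hook_coef.
  apply: polyfunM (polyfun_const _ _) _; apply: polyfun_prod => i _.
  apply: polyfunD (polyfun_const _ _); apply: polyfunD (polyfun_const _ _).
  exact: polyfunB (polyfun_size a0) (polyfun_const _ _).
have nuE n (s : 'S_n) : (a < n)%N -> (nu a rho s)%:R =
    (1 + (-1) ^+ a * signature rho * signature (cycle_type s)) * (n - a - 1)`!%:R *
    ((#|[set b : 'S_n | perm_eq (cycle_type b) ((n - a)%N :: rho)]| * (n - a))%:R / n`!%:R *
     Z.@[@size_mult n a (cycle_type s)]).
  by move=> ltan; rewrite (nu_formula s ltan rhoP a0 Prho) ZP ?cycle_type_gt0.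
split=> [|n ltan].
  (* The class ratio enters through its value at [n = a.+1], which involves [rho] only. *)
  exists ((#|pointed_class a.+1 1 rho|%:R / (a.+1)`!%:R) *: Z) => n ltan narho l _ s <-.
  by rewrite nuE // card_class_ratio // mevalZ.
(* With [n] fixed the ratio is a constant, even if n-a is a part of [rho]. *)
exists (((#|[set b : 'S_n | perm_eq (cycle_type b) ((n - a)%N :: rho)]| * (n - a))%:R
  / n`!%:R) *: Z) => l _ s <-.
by rewrite nuE // mevalZ.
Qed.
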